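(* Let $a\in(0,1]$ and $x^{(0)}\neq0$. Then $x^{(k)}\neq0$ almost surely for every $k$, and with $Z\sim\mathcal N(0,I_d)$, $$\mu_a(\sigma):=\log\sigma+\frac12\mathbb E\big[\log\|\phi_a(Z)\|^2\big],\qquad s_a^2:=\frac14\operatorname{Var}\big(\log\|\phi_a(Z)\|^2\big)$$ are finite, $\frac1k\log\|x^{(k)}\|\to\mu_a(\sigma)$ almost surely as $k\to\infty$ (a deterministic limit independent of $x^{(0)}$), and $$\frac{\log\|x^{(k)}\|-\mu_a(\sigma)k}{\sqrt k}\Rightarrow\mathcal N(0,s_a^2)\quad\text{in distribution as }k\to\infty.$$
   Context: Fix an integer width $d\ge1$ and a parameter $a\in[0,1]$. The parametric ReLU $\phi_a:\mathbb{R}\to\mathbb{R}$ is $\phi_a(z)=z$ for $z>0$ and $\phi_a(z)=az$ for $z\le 0$; it is applied componentwise to vectors ($\phi_0$ is ReLU, $\phi_1$ is the identity). Given $\sigma>0$ and a deterministic input $x^{(0)}\in\mathbb{R}^d$, the layer outputs of the fully connected network with zero biases are $x^{(k+1)}=\phi_a(W^{(k+1)}x^{(k)})$, $k\ge0$, where all entries of all matrices $W^{(1)},W^{(2)},\dots\in\mathbb{R}^{d\times d}$ are i.i.d. $\mathcal{N}(0,\sigma^2)$. $\|\cdot\|$ denotes the Euclidean norm. *)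

(* Defs.v *)
From HB Require Import structures.
From mathcomp Require Import all_boot all_order all_algebra.
From mathcomp Require Import all_classical all_reals all_analysis.
Set Implicit Arguments. Unset Strict Implicit. Unset Printing Implicit Defensive.
Import Order.TTheory GRing.Theory Num.Theory.
Import numFieldNormedType.Exports.
Local Open Scope classical_set_scope.
Local Open Scope ring_scope.

Definition prelu {R : realType} (a z : R) : R := if 0 < z then z else a * z.

Definition sqnorm {R : realType} {d : nat} (v : 'cV[R]_d) : R :=
  \sum_(i < d) (v i ord0) ^+ 2.
Definition enorm {R : realType} {d : nat} (v : 'cV[R]_d) : R :=
  Num.sqrt (sqnorm v).

(* layer outputs: x^(0) = x0, x^(k+1) = phi_a (W^(k+1) x^(k));
   here [W k] plays the role of W^(k+1). *)
Fixpoint layer {R : realType} {d : nat} (a : R) (W : nat -> 'M[R]_d)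
  (x0 : 'cV[R]_d) (k : nat) : 'cV[R]_d :=
  match k with
  | 0 => x0
  | k'.+1 => map_mx (prelu a) (W k' *m layer a W x0 k')
  end.

Definition mutually_independent {dT} {T : measurableType dT} {R : realType}
  {I : eqType} (P : probability T R) (X : I -> T -> R) : Prop :=
  (forall i, measurable_fun setT (X i)) /\
  forall (s : seq I) (B : I -> set R), uniq s ->
    (forall i, measurable (B i)) ->
    fine (P (\bigcap_(i in [set` s]) (X i @^-1` B i))) =
    \prod_(i <- s) fine (P (X i @^-1` B i)).

(* X has law N(0, s^2) (s > 0 is the standard deviation) *)
Definition has_normal_law {dT} {T : measurableType dT} {R : realType}
  (P : probability T R) (s : R) (X : T -> R) : Prop :=
  forall B : set R, measurable B -> P (X @^-1` B) = normal_prob 0 s B.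

Definition centered_normal {R : realType} (v : R) : set R -> \bar R :=
  if v == 0 then @dirac _ R 0 R else normal_prob 0 (Num.sqrt v).

Definition cvg_in_distribution {dT} {T : measurableType dT} {R : realType}
  (P : probability T R) (Y : nat -> T -> R) (mu : set R -> \bar R) : Prop :=
  forall f : R -> R, continuous f -> (exists M : R, forall x, `|f x| <= M) ->
    (fun k => fine ('E_P[f \o Y k])%E) @ \oo -->
      fine (\int[mu]_x (f x)%:E)%E.

(* Main.v *)
Require Import Defs.
From HB Require Import structures.
From mathcomp Require Import all_boot all_order all_algebra.
From mathcomp Require Import all_classical all_reals all_analysis.
From mathcomp Require Import measurable_realfun ring lra.
Set Implicit Arguments. Unset Strict Implicit. Unset Printing Implicit Defensive.
Import Order.TTheory GRing.Theory Num.Theory.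
Import numFieldNormedType.Exports.
Local Open Scope classical_set_scope.
Local Open Scope ring_scope.

(** By rotation invariance, for [x <> 0] the vector [W x] is distributed as
    [sigma ||x|| Z] whatever the direction of [x], and [prelu a] is positively
    homogeneous.  Hence [ln ||x^(k)||] is a random walk: for [g >= 0],
    [E g(ln ||x^(k+1)||) = E (E' g(ln ||x^(k)|| + ln sigma + L / 2))].  Both
    limit theorems follow from this identity alone.  The fourth moment of the
    centred walk is [O(k^2)], so [sum_k E (y_k / k)^4 < oo] gives the strong law.
    The central limit theorem is Lindeberg's replacement argument: a step of
    size [k^(-1/2)] of the walk and a Gaussian step with the same variance change
    the mean of a function with bounded third derivative by [O(k^(-3/2))], and
    such functions approximate bounded continuous ones up to [e (1 + x^2)]. *)

(** * Gaussian integrals *)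

(** Rotation invariance is obtained without rotations: the weights of a row are integrated out one
    at a time, and stability of the normal law under sums merges them into one Gaussian with
    coefficient [sigma ||x||]. This requires a fresh weight to be independent of everything computed
    before it, hence the sigma-algebras [history]. Identities are stated for nonnegative functions
    because Tonelli and image measures then ask for no integrability; bounded functions are shifted
    by a constant at the end. The vector [Z] lives on a space [P'] unrelated to [P], so the two are
    linked only through such integral identities, and no joint law of the increments is ever formed.
    The analytic obstacle is the singularity of [ln] at 0: the fourth moment of [L] must be finite
    even for [d = 1]. It is controlled by [E |Z|^(-1/2) < oo] for one coordinate, together with
    [a > 0]. The weight [1 + x^2] of the approximation takes the place of tightness, since the
    rescaled walk has bounded second moments. *)

Lemma pushforward_is_measure d1 d2 (T1 : measurableType d1)
    (T2 : measurableType d2) (R : realType)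
    (m : {measure set T1 -> \bar R}) (f : T1 -> T2) :
  measurable_fun setT f ->
  exists m' : {measure set T2 -> \bar R},
    (m' : set T2 -> \bar R) = pushforward m f.
Proof. by move=> mf; unshelve eexists (pushforward m f). Qed.

Section gaussian.
Context {R : realType}.
Local Notation mu := (@lebesgue_measure R).
Local Open Scope ereal_scope.

(** The Radon-Nikodym derivative of the law and [normal_pdf] have the same integral over every
    measurable set, hence agree almost everywhere. *)
Lemma ge0_integral_normal_prob (m s : R) (f : R -> \bar R) :
  measurable_fun [set: R] f -> (forall x, 0 <= f x) ->
  \int[normal_prob m s]_x f x = \int[mu]_x (f x * (normal_pdf m s x)%:E).
Proof.
move=> mf f0.
have dom := @normal_prob_dominates R m s.
rewrite -(Radon_Nikodym_SigmaFinite.change_of_variables dom)//=.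
have iRN := Radon_Nikodym_SigmaFinite.f_integrable dom.
have mpdf : measurable_fun [set: R] (fun x => (normal_pdf m s x)%:E).
  by apply/measurable_EFinP; exact: measurable_normal_pdf.
apply: ae_eq_integral => //.
- by apply: emeasurable_funM => //; exact: (measurable_int mu).
- exact: emeasurable_funM.
- apply: ae_eqe_mul2l.
  apply: integral_ae_eq => //= E _ mE.
  by rewrite -Radon_Nikodym_SigmaFinite.f_integral.
Qed.

(** Lebesgue measure is determined by its values on the intervals []a, b]], whose length a
    translation preserves. *)
Lemma ge0_integral_lebesgueD (c : R) (f : R -> \bar R) :
  measurable_fun [set: R] f -> (forall x, 0 <= f x) ->
  \int[mu]_x f (c + x)%R = \int[mu]_x f x.
Proof.
move=> mf f0.
have mc : @measurable_fun _ _ (measurableTypeR R) (measurableTypeR R) setT (fun x => c + x)%R.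
  exact: measurable_funD.
have := ge0_integral_pushforward mc mu measurableT mf (fun y _ => f0 y).
rewrite preimage_setT => /= <-.
apply: eq_measure_integral => A mA _; apply/esym/lebesgue_measure_unique => //=.
move=> _ [[a b] _ <-] /=.
rewrite /pushforward.
have -> : (fun x => c + x)%R @^-1` `]a, b]%classic = `](a - c)%R, (b - c)%R]%classic.
  by apply/seteqP; split => x /=; rewrite !in_itv/= => /andP[? ?]; apply/andP; split; lra.
by rewrite !lebesgue_measure_itv/= !lte_fin ltrD2r; case: ifPn => // _; rewrite -!EFinD; congr EFin; lra.
Qed.

Lemma ge0_integral_lebesgueZ (s : R) (f : R -> \bar R) : (0 < s)%R ->
  measurable_fun [set: R] f -> (forall x, 0 <= f x) ->
  \int[mu]_x f (s * x)%R = s^-1%:E * \int[mu]_x f x.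
Proof.
move=> s0 mf f0.
have mc : @measurable_fun _ _ (measurableTypeR R) (measurableTypeR R) setT (fun x => s * x)%R.
  exact: measurable_funM.
have := ge0_integral_pushforward mc mu measurableT mf (fun y _ => f0 y).
rewrite preimage_setT => /= <-.
have [pm pmE] := pushforward_is_measure mu mc.
(* Uniqueness of Lebesgue measure is applied to [s] times the image measure, since the preimage of
   []a, b]] has length [(b - a) / s]. *)
have -> : \int[mu]_x f x = \int[mscale (NngNum (ltW s0)) pm]_x f x.
  apply: eq_measure_integral => A mA _; apply/lebesgue_measure_unique => //=.
  move=> _ [[a b] _ <-] /=.
  rewrite /mscale/= pmE /pushforward.
  have -> : (fun x => s * x)%R @^-1` `]a, b]%classic = `](a / s)%R, (b / s)%R]%classic.
    by apply/seteqP; split => x /=; rewrite !in_itv/= ltr_pdivrMr// ler_pdivlMr// (mulrC x).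
  rewrite !lebesgue_measure_itv/= lebesgue_measure_itv/= !lte_fin ltr_pM2r ?invr_gt0//.
  case: ifPn => // _; last by rewrite mule0.
  rewrite -!EFinD -EFinM; congr EFin.
  by rewrite -mulrBl mulrCA divff ?mulr1// gt_eqF.
by rewrite ge0_integral_mscale//= muleA -EFinM mulVf ?mul1e ?pmE// gt_eqF.
Qed.

Lemma normal_pdf_gt0E (m s x : R) : (0 < s)%R ->
  normal_pdf m s x = (s^-1 * (Num.sqrt (pi *+ 2))^-1 *
    expR (- ((x - m) / s) ^+ 2 / 2))%R.
Proof.
move=> s0; rewrite normal_pdfE ?gt_eqF// /normal_peak /normal_fun.
rewrite -mulrnAr sqrtrM ?sqr_ge0// sqrtr_sqr gtr0_norm// invfM.
congr (_ * expR _)%R.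
by rewrite exprMn exprVn -[(_ *+ 2)%R]mulr_natr invfM mulNr mulNr !mulrA.
Qed.

Lemma ge0_integral_normal_probN (s : R) (f : R -> \bar R) : (0 < s)%R ->
  measurable_fun [set: R] f -> (forall x, 0 <= f x) ->
  \int[normal_prob 0 s]_x f (- x)%R = \int[normal_prob 0 s]_x f x.
Proof.
move=> s0 mf f0.
have mN : @measurable_fun _ _ (measurableTypeR R) (measurableTypeR R) setT -%R.
  exact: oppr_measurable.
rewrite !ge0_integral_normal_prob//; last exact: measurableT_comp.
pose g x := f x * (normal_pdf 0 s x)%:E.
have mg : measurable_fun [set: R] g.
  by apply: emeasurable_funM => //; apply/measurable_EFinP; exact: measurable_normal_pdf.
have g0 x : 0 <= g x by rewrite mule_ge0// lee_fin normal_pdf_ge0.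
have := ge0_integral_pushforward mN mu measurableT mg (fun y _ => g0 y).
rewrite preimage_setT => /= gN.
transitivity (\int[mu]_x (g \o -%R) x).
  by apply: eq_integral => x _ /=; rewrite /g !normal_pdf_gt0E// !subr0 !mulNr sqrrN.
by rewrite -gN; apply: eq_measure_integral => A mA _; exact: lebesgue_measureN.
Qed.

Lemma ge0_integral_normal_probZ (s : R) (f : R -> \bar R) : (0 < s)%R ->
  measurable_fun [set: R] f -> (forall x, 0 <= f x) ->
  \int[normal_prob 0 1]_x f (s * x)%R = \int[normal_prob 0 s]_x f x.
Proof.
move=> s0 mf f0.
have ms : measurable_fun [set: R] (fun x => s * x)%R by exact: measurable_funM.
have mfs := measurableT_comp mf ms.
rewrite (@ge0_integral_normal_prob 0 s f mf f0).
rewrite (@ge0_integral_normal_prob 0 1 _ mfs (fun x => f0 (s * x)%R)).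
pose g x := f x * (normal_pdf 0 s x)%:E.
have mg : measurable_fun [set: R] g.
  by apply: emeasurable_funM => //; apply/measurable_EFinP; exact: measurable_normal_pdf.
have g0 x : 0 <= g x by rewrite mule_ge0// lee_fin normal_pdf_ge0.
transitivity (s%:E * \int[mu]_x g (s * x)%R).
  rewrite -ge0_integralZl ?lee_fin ?ltW//; last exact: (measurableT_comp mg ms).
  apply: eq_integral => x _; rewrite /g muleCA -EFinM; congr (_ * _%:E).
  rewrite !normal_pdf_gt0E// !subr0 (mulrC s x) mulfK ?gt_eqF// divr1 invr1 mul1r.
  by rewrite -mulrA mulVKf ?gt_eqF.
by rewrite ge0_integral_lebesgueZ// muleA -EFinM divff ?mul1e// gt_eqF.
Qed.

(* The product of the two densities is, as a function of y, the density of
   N(c^2 / (c^2 + s^2) w, (c s)^2 / (c^2 + s^2)) up to the factor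
   normal_pdf 0 (sqrt (c^2 + s^2)) w. *)
Lemma normal_pdf_conv (c s w y : R) : (0 < c)%R -> (0 < s)%R ->
  let r : R := Num.sqrt (c ^+ 2 + s ^+ 2) in
  (normal_pdf 0 c y * normal_pdf 0 s (- y + w) =
   normal_pdf 0 r w * normal_pdf (c ^+ 2 / r ^+ 2 * w) (c * s / r) y)%R.
Proof.
move=> c0 s0 r.
have r0 : (0 < r)%R by rewrite sqrtr_gt0 addr_gt0// exprn_gt0.
have r2 : (r ^+ 2 = c ^+ 2 + s ^+ 2)%R by rewrite sqr_sqrtr// addr_ge0// sqr_ge0.
rewrite !normal_pdf_gt0E ?divr_gt0 ?mulr_gt0// !subr0.
rewrite mulrACA -expRD [RHS]mulrACA -expRD.
set p := (Num.sqrt _)^-1%R.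
have [c0' s0' r0'] : [/\ c != 0, s != 0 & r != 0]%R by rewrite !gt_eqF.
congr (_ * expR _)%R; first by field; rewrite c0' s0' r0'.
have rE : (r ^+ 2 != 0)%R by rewrite expf_eq0.
(* The exponents are rewritten so that [r] occurs only through [r ^+ 2]; once this is replaced by
   [c ^+ 2 + s ^+ 2], a rational identity remains. *)
transitivity (- (y ^+ 2 * s ^+ 2 + (w - y) ^+ 2 * c ^+ 2) / (c ^+ 2 * s ^+ 2) / 2)%R.
  by field; rewrite c0' s0'.
transitivity (- (w ^+ 2 / r ^+ 2 + (y - c ^+ 2 / r ^+ 2 * w) ^+ 2 * r ^+ 2 / (c ^+ 2 * s ^+ 2)) / 2)%R; last first.
  by field; rewrite c0' s0' r0'.
rewrite r2; field.
by rewrite c0' s0' -r2 rE.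
Qed.

(** A translation by [x] makes [f] depend on [w = x + y] alone, Tonelli exchanges the integrals, and
    by [normal_pdf_conv] the integral over [x] is that of a normal density, namely 1. *)
Lemma ge0_integral_normal_conv_gt0 (c s : R) (f : R -> \bar R) :
  (0 < c)%R -> (0 < s)%R ->
  measurable_fun [set: R] f -> (forall x, 0 <= f x) ->
  \int[normal_prob 0 c]_x \int[normal_prob 0 s]_y f (x + y)%R =
  \int[normal_prob 0 (Num.sqrt (c ^+ 2 + s ^+ 2))]_x f x.
Proof.
move=> c0 s0 mf f0; set r := Num.sqrt _.
have mp m t : measurable_fun [set: R] (fun x => (normal_pdf m t x)%:E).
  by apply/measurable_EFinP; exact: measurable_normal_pdf.
have p0 (m t x : R) : 0 <= (normal_pdf m t x)%:E by rewrite lee_fin normal_pdf_ge0.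
have mD : measurable_fun [set: R * R] (fun z : R * R => z.1 + z.2)%R.
  exact: measurable_funD.
have mB : measurable_fun [set: R * R] (fun z : R * R => - z.1 + z.2)%R.
  by apply: measurable_funD => //; exact: measurableT_comp.
pose h x := \int[normal_prob 0 s]_y f (x + y)%R.
have mh : measurable_fun [set: R] h.
  apply: (measurable_fun_fubini_tonelli_F (m2 := normal_prob 0 s) (fun z : R * R => f (z.1 + z.2)%R)) => //.
  exact: measurableT_comp.
have h0 x : 0 <= h x by exact: integral_ge0.
rewrite (@ge0_integral_normal_prob 0 c h mh h0).
pose g (z : R * R) := (normal_pdf 0 c z.1)%:E * (f z.2 * (normal_pdf 0 s (- z.1 + z.2)%R)%:E).
have mg : measurable_fun setT g.
  apply: emeasurable_funM; first exact: (measurableT_comp (mp _ _)).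
  apply: emeasurable_funM; first exact: (measurableT_comp mf).
  exact: (measurableT_comp (mp _ _) mB).
have g0 z : 0 <= g z by rewrite !mule_ge0.
transitivity (\int[mu]_x \int[mu]_w g (x, w)).
  apply: eq_integral => x _; rewrite /h {h mh h0}.
  have mfx : measurable_fun [set: R] (fun y => f (x + y)%R).
    by apply: measurableT_comp => //; exact: measurable_funD.
  rewrite (@ge0_integral_normal_prob 0 s _ mfx (fun y => f0 (x + y)%R)).
  have mfp : measurable_fun [set: R] (fun y => f (x + y)%R * (normal_pdf 0 s y)%:E).
    exact: emeasurable_funM.
  have fp0 y : [set: R] y -> 0 <= f (x + y)%R * (normal_pdf 0 s y)%:E.
    by rewrite mule_ge0.
  rewrite muleC -(ge0_integralZl mu measurableT mfp fp0 (p0 0%R c x)).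
  have mgx : measurable_fun [set: R] (fun w => g (x, w)).
    by apply: (measurableT_comp mg); exact: pair1_measurable.
  apply: etrans (ge0_integral_lebesgueD x mgx (fun w => g0 (x, w))).
  by apply: eq_integral => y _; rewrite /g/= addKr.
apply: (etrans (@fubini_tonelli _ _ _ _ _ mu mu g mg g0)).
rewrite (@ge0_integral_normal_prob 0 r f mf f0).
apply: eq_integral => w _.
transitivity (\int[mu]_x (f w * (normal_pdf 0 r w)%:E * (normal_pdf (c ^+ 2 / r ^+ 2 * w) (c * s / r) x)%:E)).
  apply: eq_integral => y _; rewrite /g/= muleCA -EFinM normal_pdf_conv//.
  by rewrite EFinM muleA.
have k0 : 0 <= f w * (normal_pdf 0 r w)%:E by rewrite mule_ge0.
rewrite (ge0_integralZl mu measurableT (mp _ _) (fun y _ => p0 _ _ y) k0).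
by rewrite integral_normal_pdf mule1.
Qed.

(** Symmetry of the law absorbs the sign of [c]. The coefficients met later are coordinates of
    [x^(k)], which may have any sign. *)
Lemma ge0_integral_normal_prob_scale (c : R) (f : R -> \bar R) :
  measurable_fun [set: R] f -> (forall x, 0 <= f x) ->
  \int[normal_prob 0 1]_x f (c * x)%R = \int[normal_prob 0 1]_x f (`|c| * x)%R.
Proof.
move=> mf f0; have [c0|c0] := leP 0%R c; first by rewrite ger0_norm.
rewrite ltr0_norm//.
rewrite -[RHS]ge0_integral_normal_probN//.
  by apply: eq_integral => x _; rewrite mulrNN.
by apply: measurableT_comp => //; exact: measurable_funM.
Qed.

Lemma ge0_integral_normal_conv (c s : R) (f : R -> \bar R) :
  measurable_fun [set: R] f -> (forall x, 0 <= f x) ->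
  \int[normal_prob 0 1]_x \int[normal_prob 0 1]_y f (c * x + s * y)%R =
  \int[normal_prob 0 1]_x f (Num.sqrt (c ^+ 2 + s ^+ 2) * x)%R.
Proof.
move=> mf f0.
have cst1 (M : \bar R) : \int[normal_prob (0 : R) 1]_x M = M.
  by rewrite integral_cst// [X in _ * X](@probability_setT _ _ _ (normal_prob (0 : R) 1)) mule1.
(* A zero coefficient yields a constant, which has no density, so these two cases are settled before
   densities are convolved. *)
have [->|c0] := eqVneq c 0%R.
  under eq_integral do under eq_integral do rewrite mul0r add0r.
  by rewrite cst1 ge0_integral_normal_prob_scale// expr0n/= add0r sqrtr_sqr.
have [->|s0] := eqVneq s 0%R.
  under eq_integral do under eq_integral do rewrite mul0r addr0.
  under eq_integral do rewrite cst1.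
  by rewrite ge0_integral_normal_prob_scale// expr0n/= addr0 sqrtr_sqr.
have {}c0 : (0 < `|c|)%R by rewrite normr_gt0.
have {}s0 : (0 < `|s|)%R by rewrite normr_gt0.
have mM (t : R) : measurable_fun [set: R] (fun x => t * x)%R by exact: measurable_funM.
have mD (t : R) : measurable_fun [set: R] (fun x => t + x)%R by exact: measurable_funD.
transitivity (\int[normal_prob 0 1]_x \int[normal_prob 0 `|s|]_y f (c * x + y)%R).
  apply: eq_integral => x _.
  have mfx : measurable_fun [set: R] (fun y => f (c * x + y)%R).
    exact: measurableT_comp.
  apply: etrans (ge0_integral_normal_probZ s0 mfx (fun y => f0 _)).
  exact: (ge0_integral_normal_prob_scale s mfx (fun y => f0 _)).
pose g x := \int[normal_prob 0 `|s|]_y f (x + y)%R.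
have mg : measurable_fun [set: R] g.
  apply: (measurable_fun_fubini_tonelli_F (m2 := normal_prob 0 `|s|) (fun z : R * R => f (z.1 + z.2)%R)) => //.
  by apply: measurableT_comp => //; exact: measurable_funD.
have g0 x : 0 <= g x by exact: integral_ge0.
have r0 : (0 < Num.sqrt (c ^+ 2 + s ^+ 2))%R.
  by rewrite sqrtr_gt0 -(real_normK (num_real c)) -(real_normK (num_real s)) addr_gt0 ?exprn_gt0.
apply: (etrans (ge0_integral_normal_prob_scale c mg g0)).
apply: (etrans (ge0_integral_normal_probZ c0 mg g0)).
apply: (etrans (ge0_integral_normal_conv_gt0 c0 s0 mf f0)).
rewrite (real_normK (num_real c)) (real_normK (num_real s)).
exact: (esym (ge0_integral_normal_probZ r0 mf f0)).
Qed.

End gaussian.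

(* [normal_prob] lives on [measurableTypeR R], whose display differs from the
   one of the canonical measurable structure of [R]. *)
Section normalR.
Context {R : realType}.
Local Open Scope ereal_scope.

Let mid : measurable_fun setT (id : measurableTypeR R -> R).
Proof. by move=> _ A mA; rewrite setTI preimage_id. Qed.

Let idR : {mfun measurableTypeR R >-> R} :=
  HB.pack (id : measurableTypeR R -> R)
    (isMeasurableFun.Build _ _ _ _ (id : measurableTypeR R -> R) mid).

Definition normalR (m s : R) : probability R R :=
  distribution (normal_prob m s) idR.

Lemma normalRE (m s : R) : normalR m s = normal_prob m s :> (set R -> \bar R).
Proof. by []. Qed.

Lemma ge0_integral_normalR (m s : R) (f : R -> \bar R) :
  measurable_fun [set: R] f -> (forall x, 0 <= f x) ->
  \int[normalR m s]_x f x = \int[normal_prob m s]_x f x.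
Proof.
move=> mf f0.
have := ge0_integral_pushforward mid (normal_prob m s) measurableT mf (fun y _ => f0 y).
by rewrite preimage_setT.
Qed.

Lemma ge0_integral_normalR_pdf (m s : R) (f : R -> \bar R) :
  measurable_fun [set: R] f -> (forall x, 0 <= f x) ->
  \int[normalR m s]_x f x =
  \int[lebesgue_measure]_x (f x * (normal_pdf m s x)%:E).
Proof.
move=> mf f0; apply: etrans (ge0_integral_normalR m s mf f0) _.
exact: ge0_integral_normal_prob.
Qed.

Lemma ge0_integral_normalRN (f : R -> \bar R) :
  measurable_fun [set: R] f -> (forall x, 0 <= f x) ->
  \int[normalR 0 1]_x f (- x)%R = \int[normalR 0 1]_x f x.
Proof.
move=> mf f0.
have mfN : measurable_fun [set: R] (fun x => f (- x)%R).
  by apply: measurableT_comp => //; exact: oppr_measurable.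
apply: etrans (ge0_integral_normalR 0 1 mfN (fun x => f0 _)) _.
apply: etrans (esym (ge0_integral_normalR 0 1 mf f0)).
exact: ge0_integral_normal_probN.
Qed.

Lemma ge0_integral_normalRZ (s : R) (f : R -> \bar R) : (0 < s)%R ->
  measurable_fun [set: R] f -> (forall x, 0 <= f x) ->
  \int[normalR 0 s]_x f x = \int[normalR 0 1]_x f (s * x)%R.
Proof.
move=> s0 mf f0.
have mfs : measurable_fun [set: R] (fun x => f (s * x)%R).
  by apply: measurableT_comp => //; exact: measurable_funM.
apply: etrans (ge0_integral_normalR 0 s mf f0) _.
apply: etrans (esym (ge0_integral_normalR 0 1 mfs (fun x => f0 _))).
exact/esym/ge0_integral_normal_probZ.
Qed.

(** Stability of the normal law, in the form that later sections assume under the name [gammaD]. *)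
Lemma ge0_integral_normalRD (c s : R) (f : R -> \bar R) :
  measurable_fun [set: R] f -> (forall x, 0 <= f x) ->
  \int[normalR 0 1]_x \int[normalR 0 1]_y f (c * x + s * y)%R =
  \int[normalR 0 1]_x f (Num.sqrt (c ^+ 2 + s ^+ 2) * x)%R.
Proof.
move=> mf f0.
have mM (t : R) : measurable_fun [set: R] (fun x => t * x)%R by exact: measurable_funM.
have mfr : measurable_fun [set: R] (fun x => f (Num.sqrt (c ^+ 2 + s ^+ 2) * x)%R).
  exact: measurableT_comp.
apply: etrans (esym (ge0_integral_normalR 0 1 mfr (fun x => f0 _))).
apply: etrans (ge0_integral_normal_conv c s mf f0).
have mf2 : measurable_fun [set: R * R] (fun z : R * R => f (c * z.1 + s * z.2)%R).
  by apply: measurableT_comp => //; apply: measurable_funD; exact: measurable_funM.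
have mF : measurable_fun [set: R] (fun x => \int[normalR 0 1]_y f (c * x + s * y)%R).
  exact: (measurable_fun_fubini_tonelli_F (m2 := normalR 0 1) _ mf2).
have F0 x : 0 <= \int[normalR 0 1]_y f (c * x + s * y)%R by exact: integral_ge0.
apply: etrans (ge0_integral_normalR 0 1 mF F0) _.
apply: eq_integral => x _.
apply: ge0_integral_normalR => //.
exact: (measurableT_comp mf2 (pair1_measurable x)).
Qed.

End normalR.

(** * Independence *)

Section integral_independent.
Local Open Scope ereal_scope.
Context dT dE dF (T : measurableType dT) (E : measurableType dE)
  (F : measurableType dF) (R : realType) (P : probability T R)
  (nu : probability F R) (U : T -> E) (V : T -> F).
Hypothesis mU : measurable_fun setT U.
Hypothesis mV : measurable_fun setT V.
Hypothesis UV : forall A B, measurable A -> measurable B ->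
  P (U @^-1` A `&` V @^-1` B) = P (U @^-1` A) * nu B.

(** On rectangles the law of [(U, V)] is the product of the law of [U] and [nu], hence it is that
    product; Tonelli does the rest. *)
Lemma ge0_integral_indep (G : E * F -> \bar R) :
  measurable_fun setT G -> (forall z, 0 <= G z) ->
  \int[P]_w G (U w, V w) = \int[P]_w \int[nu]_v G (U w, v).
Proof.
move=> mG G0.
have mUV : measurable_fun setT (fun w => (U w, V w)) by exact: measurable_fun_pair.
pose U' : {mfun T >-> E} := HB.pack U (isMeasurableFun.Build _ _ _ _ U mU).
have := ge0_integral_pushforward mUV P measurableT mG (fun y _ => G0 y).
rewrite preimage_setT => /= <-.
have [m mE] := pushforward_is_measure P mUV.
transitivity (\int[distribution P U' \x nu]_z G z).
  apply: eq_measure_integral => A mA _; apply/esym.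
  apply: etrans (congr1 (fun h => h A) mE).
  by apply: product_measure_unique => // B C mB mC; rewrite mE /pushforward -UV.
rewrite fubini_tonelli1//.
have mF : measurable_fun setT (fubini_F nu G).
  exact: measurable_fun_fubini_tonelli_F.
have F0 x : 0 <= fubini_F nu G x by exact: integral_ge0.
have := ge0_integral_pushforward mU P measurableT mF (fun y _ => F0 y).
by rewrite preimage_setT.
Qed.

End integral_independent.

(** * Sigma-algebras generated by part of a family of independent variables *)

Section history.
Context dT (T : measurableType dT) (R : realType) (I : eqType).
Implicit Types (X : I -> T -> R) (S : set I).

(** The pi-system about which [mutually_independent] speaks directly. *)
Definition cylinders X S : set (set T) :=
  [set A | exists s (B : I -> set R), [/\ uniq s, [set` s] `<=` S,
     forall i, measurable (B i) & A = \bigcap_(i in [set` s]) (X i @^-1` B i)]].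

(** The set [T] with the sigma-algebra generated by the variables indexed by [S]. As a type of its
    own, it turns dependence on these variables alone into plain measurability, and inclusion of
    sigma-algebras into measurability of [id]. *)
Definition history X S := g_sigma_algebraType (cylinders X S).

HB.instance Definition _ X S := Measurable.on (history X S).

Lemma cylindersI X S : setI_closed (cylinders X S).
Proof.
move=> _ _ [s [B [us sS mB ->]]] [t [C [ut tS mC ->]]].
(* An index absent from one of the lists contributes [setT] on that side; [undup] restores
   uniqueness of the merged list. *)
exists (undup (s ++ t)), (fun i => (if i \in s then B i else setT) `&`
                                   (if i \in t then C i else setT)).
split => [||i|].
- exact: undup_uniq.
- move=> i /=; rewrite mem_undup mem_cat => /orP[] ?; [exact: sS|exact: tS].
- by apply: measurableI; case: ifP.
apply/seteqP; split => w /=.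
  move=> [Bw Cw] i /=; rewrite mem_undup mem_cat => _; split.
    by case: ifPn => // /Bw.
  by case: ifPn => // /Cw.
move=> h; split => i /= si.
  by have := h i; rewrite /= mem_undup mem_cat si /= => /(_ isT)[].
by have := h i; rewrite /= mem_undup mem_cat si orbT /= => /(_ isT)[].
Qed.

Lemma cylinders_measurable X S : (forall i, measurable_fun setT (X i)) ->
  cylinders X S `<=` measurable.
Proof.
move=> mX _ [s [B [us sS mB ->]]].
apply: fin_bigcap_measurable => // i _.
rewrite -[X in measurable X]setTI; exact: mX.
Qed.

Lemma measurable_id_history X S : (forall i, measurable_fun setT (X i)) ->
  measurable_fun setT (id : T -> history X S).
Proof.
move=> mX _ A mA; rewrite setTI preimage_id.
apply: (smallest_sub _ (@cylinders_measurable X S mX) mA).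
exact: sigma_algebra_measurable.
Qed.

Lemma history_sub X S S' : S `<=` S' ->
  measurable_fun setT (id : history X S' -> history X S).
Proof.
move=> SS' _ A mA; rewrite setTI preimage_id.
apply: (smallest_sub _ _ mA).
  exact: (@sigma_algebra_measurable _ (history X S')).
move=> B [s [C [us sS mC ->]]]; apply: sub_sigma_algebra.
by exists s, C; split => //; exact: subset_trans SS'.
Qed.

Lemma measurable_history X S i : S i ->
  measurable_fun setT (X i : history X S -> R).
Proof.
move=> Si _ B mB; rewrite setTI; apply: sub_sigma_algebra.
exists [:: i], (fun=> B); split => //.
  by move=> j /=; rewrite inE => /eqP ->.
by rewrite set_cons1 bigcap_set1.
Qed.

(** For fixed [B], both sides are finite measures in [A] on the history. They agree on cylinders,
    and a pi-system containing the whole space determines such measures. *)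
Lemma history_indep (P : probability T R) X S i (A : set T) (B : set R) :
  mutually_independent P X -> ~ S i ->
  measurable (A : set (history X S)) -> measurable B ->
  P (A `&` X i @^-1` B) = (P A * P (X i @^-1` B))%E.
Proof.
move=> [mX PX] Si mA mB.
have mC : measurable (X i @^-1` B) by rewrite -[X in measurable X]setTI; exact: mX.
have mid := @measurable_id_history X S mX.
have fP (D : set T) : measurable D -> (fine (P D))%:E = P D.
  by move=> mD; rewrite fineK// fin_num_measure.
have [m1 m1E] := pushforward_is_measure (mrestr P mC) mid.
have p0 : 0 <= fine (P (X i @^-1` B)) by rewrite fine_ge0.
have [m2 m2E] := pushforward_is_measure (mscale (NngNum p0) P) mid.
suff : m1 A = m2 A.
  by rewrite m1E m2E /pushforward/= /mrestr /mscale/= preimage_id fP// muleC.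
apply: (@measure_unique _ R (history X S) (cylinders X S) (fun=> setT) _ _ _ _ m1 m2) => //.
- exact: cylindersI.
- move=> _; exists [::], (fun=> setT); split => //.
  by rewrite set_nil bigcap_set0.
- by rewrite bigcup_const.
- move=> D cD; have [s [C [us sS mCi DE]]] := cD.
  have mD := cylinders_measurable mX cD.
  rewrite m1E m2E /pushforward/= /mrestr /mscale/= preimage_id.
  rewrite -[LHS]fP; last exact: measurableI.
  rewrite -(fP D)// -EFinM; congr EFin.
  (* Independence is applied to [s] extended by [i], which stays duplicate-free because [s] lies in
     [S] and [i] does not. *)
  have is_ : i \notin s by apply/negP => /sS.
  have := PX (i :: s) (fun j => if j == i then B else C j).
  rewrite /= is_ us => /(_ isT); rewrite big_cons eqxx.
  have -> : \bigcap_(j in [set` i :: s]) (X j @^-1` (if j == i then B else C j))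
      = D `&` X i @^-1` B.
    rewrite DE; apply/seteqP; split => w /=.
      move=> h; split; last by have := h i; rewrite /= mem_head eqxx => /(_ isT).
      move=> j /= js; have := h j; rewrite /= inE js orbT => /(_ isT).
      by case: eqP js => // ->; rewrite (negbTE is_).
    move=> [h Bi] j /=; rewrite inE; case: eqP => [->//|_ /= js].
    exact: h.
  move=> -> => [|j]; last by case: ifP.
  congr (_ * _); rewrite DE PX//.
  apply: eq_big_seq => j js; case: eqP js => // ->.
  by rewrite (negbTE is_).
- move=> _; rewrite m1E /pushforward/= /mrestr/= preimage_setT setTI.
  exact: (le_lt_trans (probability_le1 _ _)) (ltry _).
Qed.

(** The form in which independence is used: one fresh variable is integrated out against its law
    while [w], through which the past enters, stays frozen. *)
Lemma ge0_integral_history (P : probability T R) (nu : probability R R) X S i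
    (G : T * R -> \bar R) :
  mutually_independent P X -> ~ S i ->
  (forall B, measurable B -> P (X i @^-1` B) = nu B) ->
  measurable_fun setT (G : history X S * R -> \bar R) -> (forall z, 0 <= G z)%E ->
  (\int[P]_w G (w, X i w) = \int[P]_w \int[nu]_v G (w, v))%E.
Proof.
move=> iX Si lX mG G0; have [mX _] := iX.
apply: (@ge0_integral_indep _ _ _ T (history X S) R R P nu id (X i)) => //.
- exact: measurable_id_history.
- by move=> A B mA mB; rewrite preimage_id history_indep// lX.
Qed.

End history.

(** * One layer of the network *)

Section prelu.
Context {R : realType}.
Implicit Types a c z : R.

Lemma preluZ a c z : 0 <= c -> prelu a (c * z) = c * prelu a z.
Proof.
rewrite le_eqVlt => /predU1P[<-|c0]; first by rewrite /prelu !mul0r ltxx mulr0.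
by rewrite /prelu pmulr_rgt0//; case: ifP => // _; rewrite mulrCA.
Qed.

Lemma measurable_prelu a : measurable_fun [set: R] (prelu a).
Proof.
by apply: measurable_fun_ifT => //; exact: measurable_fun_ltr.
Qed.

End prelu.

(** Membership matters: in the uses below, only the terms that occur in the list are known to be
    measurable for the history at hand. *)
Lemma measurable_sum_seq d (T : measurableType d) (R : realType) (I : eqType)
    (s : seq I) (h : I -> T -> R) :
  (forall i, i \in s -> measurable_fun setT (h i)) ->
  measurable_fun setT (fun x => \sum_(i <- s) h i x).
Proof.
elim: s => [mh|i s ih mh].
  by under eq_fun do rewrite big_nil//=; exact: measurable_cst.
under eq_fun do rewrite big_cons//=; apply: measurable_funD.
  by apply: mh; rewrite mem_head.
by apply: ih => j js; apply: mh; rewrite in_cons js orbT.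
Qed.

Section one_step.
Local Open Scope ereal_scope.
Context dT (T : measurableType dT) (R : realType) (P : probability T R)
  (I : eqType) (X : I -> T -> R) (nu gamma : probability R R) (sigma : R).
Hypothesis iX : mutually_independent P X.
Hypothesis lX : forall i B, measurable B -> P (X i @^-1` B) = nu B.
Hypothesis sigma0 : (0 <= sigma)%R.
Hypothesis nuE : forall f : R -> \bar R, measurable_fun setT f ->
  (forall x, 0 <= f x) -> \int[nu]_x f x = \int[gamma]_x f (sigma * x)%R.
Hypothesis gammaD : forall (c s : R) (f : R -> \bar R),
  measurable_fun setT f -> (forall x, 0 <= f x) ->
  \int[gamma]_x \int[gamma]_y f (c * x + s * y)%R =
  \int[gamma]_x f (Num.sqrt (c ^+ 2 + s ^+ 2) * x)%R.

(** Induction on the row. The first weight, independent of the others, is integrated out against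
    [nu]; by induction the remaining sum becomes one Gaussian; [gammaD] merges the two, and the
    squares of the coefficients add up. [G] may depend on the past because the induction hypothesis
    is applied to an integrand that contains [x j0 w]. *)
Lemma ge0_integral_row (J : eqType) (s : seq J) (S : set I) (c : J -> I)
    (x : J -> T -> R) (G : T * R -> \bar R) :
  uniq s -> {in s &, injective c} -> (forall j, j \in s -> ~ S (c j)) ->
  (forall j, measurable_fun setT (x j : history X S -> R)) ->
  measurable_fun setT (G : history X S * R -> \bar R) -> (forall z, 0 <= G z) ->
  \int[P]_w G (w, \sum_(j <- s) X (c j) w * x j w)%R =
  \int[P]_w \int[gamma]_z
    G (w, sigma * Num.sqrt (\sum_(j <- s) x j w ^+ 2) * z)%R.
Proof.
elim: s G => [|j0 s IH] G us cI cS mx mG G0.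
  apply: eq_integral => w _; rewrite !big_nil sqrtr0 mulr0.
  under eq_integral do rewrite mul0r.
  by rewrite integral_cst// [X in _ * X]probability_setT mule1.
move: us => /= /andP[j0s us].
(* The past is enlarged by the weights still to come in the row, so that the weight of [j0] is
   independent of the partial sum [Y] as well. *)
pose S' := S `|` [set c j | j in [set` s]].
have SS' : S `<=` S' by exact: subsetUl.
have mH := history_sub (X := X) SS'.
have j0S' : ~ S' (c j0).
  move=> [|[j /= js jj0]]; first by apply: cS; rewrite mem_head.
  have : j = j0 by apply: cI => //; rewrite ?mem_head// in_cons js orbT.
  by move=> jE; move: j0s; rewrite -jE js.
pose Y w := (\sum_(j <- s) X (c j) w * x j w)%R.
have mY : measurable_fun setT (Y : history X S' -> R).
  apply: (@measurable_sum_seq _ (history X S')) => j js.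
  apply: measurable_funM; last exact: measurableT_comp (mx j) mH.
  by apply: measurable_history; right; exists j.
pose A (w : T) (y v : R) := G (w, v * x j0 w + y)%R.
have mA : measurable_fun setT
    ((fun p => A p.1.1 p.1.2 p.2) : (history X S * R) * R -> \bar R).
  apply: (measurableT_comp mG); apply: measurable_fun_pair.
    exact: (measurableT_comp measurable_fst measurable_fst).
  apply: measurable_funD.
    apply: measurable_funM => //.
    exact: (measurableT_comp (mx j0) (measurableT_comp measurable_fst measurable_fst)).
  exact: (measurableT_comp measurable_snd measurable_fst).
have A0 w y v : 0 <= A w y v by exact: G0.
pose G2 (p : T * R) := \int[nu]_v A p.1 p.2 v.
have mG2 : measurable_fun setT (G2 : history X S * R -> \bar R).
  exact: (measurable_fun_fubini_tonelli_F (m2 := nu) _ mA).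
have G20 p : 0 <= G2 p by exact: integral_ge0.
transitivity (\int[P]_w G2 (w, Y w)).
  under eq_integral do rewrite big_cons.
  apply: (@ge0_integral_history _ T R I P nu X S' (c j0)
    (fun p => A p.1 (Y p.1) p.2) iX j0S' (@lX (c j0))) => //.
  have mg : measurable_fun setT ((fun p => ((p.1, Y p.1), p.2)) :
      history X S' * R -> (history X S * R) * R).
    apply: measurable_fun_pair => //; apply: measurable_fun_pair => //.
      exact: (measurableT_comp mH measurable_fst).
    exact: (measurableT_comp mY measurable_fst).
  exact: (measurableT_comp mA mg).
have cIs : {in s &, injective c}.
  by move=> j k js ks; apply: cI; rewrite in_cons ?js ?ks orbT.
have cSs j : j \in s -> ~ S (c j).
  by move=> js; apply: cS; rewrite in_cons js orbT.
rewrite (IH G2 us cIs cSs mx mG2 G20).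
apply: eq_integral => w _; rewrite big_cons.
set r2 := (\sum_(j <- s) _)%R.
have r20 : (0 <= r2)%R by apply: sumr_ge0 => j _; exact: sqr_ge0.
have mGw : measurable_fun setT (fun y => G (w, y)).
  exact: (measurableT_comp mG (pair1_measurable (w : history X S))).
transitivity (\int[gamma]_z \int[gamma]_v
    G (w, (sigma * Num.sqrt r2) * z + (sigma * x j0 w) * v)%R).
  apply: eq_integral => z _; rewrite /G2/= nuE//.
    by apply: eq_integral => v _; rewrite /A addrC (mulrAC sigma v).
  apply: (measurableT_comp mGw); apply: measurable_funD => //.
  exact: measurable_funM.
rewrite (@gammaD _ _ (fun y => G (w, y)) mGw (fun y => G0 (w, y))).
apply: eq_integral => z _; congr (G (w, _ * _)%R).
rewrite !exprMn sqr_sqrtr// -mulrDr sqrtrM ?sqr_ge0// sqrtr_sqr ger0_norm//.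
by rewrite addrC.
Qed.

End one_step.

Section network_step.
Local Open Scope ereal_scope.
Context dT (T : measurableType dT) (R : realType) (P : probability T R)
  dT' (T' : measurableType dT') (P' : probability T' R)
  (I J K : eqType) (X : I -> T -> R) (Z : K -> T' -> R)
  (nu gamma : probability R R) (sigma a : R).
Hypothesis iX : mutually_independent P X.
Hypothesis lX : forall i B, measurable B -> P (X i @^-1` B) = nu B.
Hypothesis iZ : mutually_independent P' Z.
Hypothesis lZ : forall i B, measurable B -> P' (Z i @^-1` B) = gamma B.
Hypothesis sigma0 : (0 <= sigma)%R.
Hypothesis nuE : forall f : R -> \bar R, measurable_fun setT f ->
  (forall x, 0 <= f x) -> \int[nu]_x f x = \int[gamma]_x f (sigma * x)%R.
Hypothesis gammaD : forall (c s : R) (f : R -> \bar R),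
  measurable_fun setT f -> (forall x, 0 <= f x) ->
  \int[gamma]_x \int[gamma]_y f (c * x + s * y)%R =
  \int[gamma]_x f (Num.sqrt (c ^+ 2 + s ^+ 2) * x)%R.

(** Rows use disjoint sets of weights, so they are integrated out one after the other. Each becomes
    [sigma ||x||] times a standard Gaussian, and [prelu a] lets this nonnegative factor out. On
    [P'], independence of the [Z k] reassembles these Gaussians into one vector. *)
Lemma ge0_integral_rows (s : seq K) (t : seq J) (S : set I) (c : K * J -> I)
    (x : J -> T -> R) (G : T * R -> \bar R) :
  uniq s -> uniq t -> injective c -> (forall k j, k \in s -> ~ S (c (k, j))) ->
  (forall j, measurable_fun setT (x j : history X S -> R)) ->
  measurable_fun setT (G : history X S * R -> \bar R) -> (forall z, 0 <= G z) ->
  \int[P]_w G (w, \sum_(k <- s)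
     prelu a (\sum_(j <- t) X (c (k, j)) w * x j w) ^+ 2)%R =
  \int[P]_w \int[P']_w' G (w, sigma ^+ 2 * (\sum_(j <- t) x j w ^+ 2) *
     \sum_(k <- s) prelu a (Z k w') ^+ 2)%R.
Proof.
elim: s G => [|k0 s IH] G us ut cI cS mx mG G0.
  apply: eq_integral => w _; rewrite !big_nil.
  under eq_integral do rewrite big_nil mulr0.
  by rewrite integral_cst// [X in _ * X]probability_setT mule1.
move: us => /= /andP[k0s us].
pose S' := S `|` [set c (k, j) | k in [set` s] & j in setT].
have SS' : S `<=` S' by exact: subsetUl.
have mH := history_sub (X := X) SS'.
have k0S' j : ~ S' (c (k0, j)).
  move=> [|[k /= ks [j' _ /cI [kk0 _]]]]; first by apply: cS; rewrite mem_head.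
  by move: k0s; rewrite -kk0 ks.
have mP a' := @measurable_prelu R a'.
pose y k w := (\sum_(j <- t) X (c (k, j)) w * x j w)%R.
pose Q w := (\sum_(k <- s) prelu a (y k w) ^+ 2)%R.
pose r2 w := (\sum_(j <- t) x j w ^+ 2)%R.
have r20 w : (0 <= r2 w)%R by apply: sumr_ge0 => j _; exact: sqr_ge0.
have mr2 : measurable_fun setT (r2 : history X S -> R).
  by apply: (@measurable_sum _ (history X S)) => j; exact: measurable_funX.
have mQ : measurable_fun setT (Q : history X S' -> R).
  apply: (@measurable_sum_seq _ (history X S')) => k ks.
  apply: measurable_funX; apply: (measurableT_comp (mP a)).
  apply: (@measurable_sum _ (history X S')) => j.
  apply: measurable_funM; last exact: measurableT_comp (mx j) mH.
  by apply: measurable_history; right; exists k => //; exists j.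
pose A (w : T) (q v : R) := G (w, prelu a v ^+ 2 + q)%R.
have mA : measurable_fun setT
    ((fun p => A p.1.1 p.1.2 p.2) : (history X S * R) * R -> \bar R).
  apply: (measurableT_comp mG); apply: measurable_fun_pair.
    exact: (measurableT_comp measurable_fst measurable_fst).
  apply: measurable_funD.
    by apply: measurable_funX; exact: (measurableT_comp (mP a) measurable_snd).
  exact: (measurableT_comp measurable_snd measurable_fst).
have A0 w q v : 0 <= A w q v by exact: G0.
pose G2 (p : T * R) := \int[gamma]_z A p.1 p.2 (sigma * Num.sqrt (r2 p.1) * z)%R.
have mG2 : measurable_fun setT (G2 : history X S * R -> \bar R).
  apply: (measurable_fun_fubini_tonelli_F (m2 := gamma)
    ((fun p => A p.1.1 p.1.2 (sigma * Num.sqrt (r2 p.1.1) * p.2)%R) :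
     (history X S * R) * R -> \bar R)) => //.
  apply: (measurableT_comp mA (g := fun p : (history X S * R) * R =>
    (p.1, sigma * Num.sqrt (r2 p.1.1) * p.2)%R)).
  apply: measurable_fun_pair => //; apply: measurable_funM => //.
  apply: measurable_funM => //.
  apply: (measurableT_comp (continuous_measurable_fun (@sqrt_continuous R))).
  exact: (measurableT_comp mr2 (measurableT_comp measurable_fst measurable_fst)).
have G20 p : 0 <= G2 p by exact: integral_ge0.
transitivity (\int[P]_w G2 (w, Q w)).
  under eq_integral do rewrite big_cons.
  apply: (@ge0_integral_row _ T R P I X nu gamma sigma iX lX sigma0 nuE gammaD
    J t S' (fun j => c (k0, j)) x (fun p => A p.1 (Q p.1) p.2)) => //.
  - by move=> j j' _ _ /cI[].
  - by move=> j; exact: measurableT_comp (mx j) mH.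
  - have mg : measurable_fun setT ((fun p => ((p.1, Q p.1), p.2)) :
        history X S' * R -> (history X S * R) * R).
      apply: measurable_fun_pair => //; apply: measurable_fun_pair => //.
        exact: (measurableT_comp mH measurable_fst).
      exact: (measurableT_comp mQ measurable_fst).
    exact: (measurableT_comp mA mg).
have cSs k j : k \in s -> ~ S (c (k, j)).
  by move=> ks; apply: cS; rewrite in_cons ks orbT.
rewrite (IH G2 us ut cI cSs mx mG2 G20).
apply: eq_integral => w _; rewrite -/(r2 w).
have mGw : measurable_fun setT (fun y => G (w, y)).
  exact: (measurableT_comp mG (pair1_measurable (w : history X S))).
pose Q' w' := (\sum_(k <- s) prelu a (Z k w') ^+ 2)%R.
have mQ' : measurable_fun setT (Q' : history Z [set` s] -> R).
  apply: (@measurable_sum_seq _ (history Z [set` s])) => k ks.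
  apply: measurable_funX; apply: (measurableT_comp (mP a)).
  exact: measurable_history.
(* The same conditioning on the second space: [Z k0] is split off from the coordinates in [s]. *)
have := @ge0_integral_history _ T' R K P' gamma Z [set` s] k0
  (fun p => G (w, sigma ^+ 2 * r2 w * (prelu a p.2 ^+ 2 + Q' p.1))%R) iZ.
move=> /(_ (elimN idP k0s) (lZ k0) _ (fun p => G0 _)) H.
transitivity (\int[P']_w' G (w, sigma ^+ 2 * r2 w * (prelu a (Z k0 w') ^+ 2 + Q' w'))%R); last first.
  by apply: eq_integral => w' _; rewrite big_cons.
rewrite H.
  apply: eq_integral => w' _; rewrite /G2/=; apply: eq_integral => z _.
  rewrite /A preluZ ?mulr_ge0 ?sqrtr_ge0// !exprMn sqr_sqrtr//.
  by rewrite -/(Q' w') mulrDr.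
apply: (measurableT_comp mGw); apply: measurable_funM => //.
apply: measurable_funD.
  by apply: measurable_funX; exact: (measurableT_comp (mP a) measurable_snd).
exact: (measurableT_comp mQ' measurable_fst).
Qed.

End network_step.

(** * Gaussian moments *)

Section series_inv_sqr.
Context {R : realType}.
Local Open Scope ereal_scope.

Lemma nneseries_inv_sqr_lty : \sum_(n <oo) (n.+1%:R ^- 2 : R)%:E < +oo.
Proof.
apply: (@le_lt_trans _ _ 2%:E); last exact: ltry.
apply: lime_le.
  by apply: is_cvg_nneseries => n _ _; rewrite lee_fin invr_ge0 exprn_ge0.
apply: nearW => n; rewrite sumEFin lee_fin.
(* The bound is 0 for the empty sum, and it telescopes: [2 / x - 2 / (x + 1) >= x ^- 2] as soon as
   [x >= 1]. *)
suff : (\sum_(0 <= i < n) (i.+1%:R ^- 2 : R) <= 2 - 2 / n.+1%:R)%R.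
  by move=> /le_trans; apply; rewrite gerBl divr_ge0.
elim: n => [|n IH]; first by rewrite big_nil divr1 subrr.
rewrite big_nat_recr//= (le_trans (lerD IH (lexx _)))//.
set x : R := n.+1%:R.
have x1 : (1 <= x)%R by rewrite ler1n.
have -> : n.+2%:R = (x + 1)%R :> R by rewrite /x -[in LHS]natr1.
have x0 : (0 < x)%R by rewrite (lt_le_trans _ x1).
have x10 : (0 < x + 1)%R by rewrite addr_gt0.
rewrite -subr_ge0.
have -> : (2 - 2 / (x + 1) - (2 - 2 / x + x ^- 2) = (x - 1) / (x ^+ 2 * (x + 1)))%R.
  by field; rewrite !gt_eqF.
by rewrite divr_ge0 ?subr_ge0// mulr_ge0 ?ltW// exprn_gt0.
Qed.

End series_inv_sqr.

Section fourth_moment.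
Context dT (T : measurableType dT) (R : realType) (P : probability T R).
Variable f : T -> R.
Hypothesis mf : measurable_fun setT f.
Hypothesis f4 : P.-integrable setT (EFin \o (fun w => f w ^+ 4)).

(** Since [|f| ^+ n <= 1 + f ^+ 4], one hypothesis on the fourth moment provides every moment used
    later. *)
Lemma integrable_pow_le4 n : (n <= 4)%N ->
  P.-integrable setT (EFin \o (fun w => f w ^+ n)).
Proof.
move=> n4; apply: (@le_integrable _ _ _ P setT measurableT _ (EFin \o (fun w => 1 + f w ^+ 4))).
- by apply/measurable_EFinP; exact: measurable_funX.
- move=> w _ /=; rewrite lee_fin normrX.
  rewrite [leRHS]ger0_norm ?addr_ge0 ?exprn_even_ge0//.
  rewrite -(@ger0_norm _ (f w ^+ 4)) ?exprn_even_ge0// normrX.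
  have [f1|f1] := leP `|f w| 1.
    by rewrite (le_trans (exprn_ile1 _ _ _))// lerDl exprn_ge0.
  by rewrite (le_trans (ler_weXn2l (ltW f1) n4))// lerDr.
- rewrite (_ : _ \o _ = (EFin \o cst 1%R) \+ (EFin \o (fun w => f w ^+ 4)%R))%E//.
  by apply: integrableD => //; exact: finite_measure_integrable_cst.
Qed.

Lemma integrable_norm3 : P.-integrable setT (EFin \o (fun w => `|f w| ^+ 3)).
Proof.
have := integrable_norm (integrable_pow_le4 (isT : 3 <= 4)%N).
by apply: eq_integrable => // w _ /=; rewrite normrX.
Qed.

End fourth_moment.

Section normal_moments.
Context {R : realType}.
Local Open Scope ereal_scope.
Local Notation mu := (@lebesgue_measure R).
Local Notation gamma := (normalR (0 : R) 1).

Lemma integrable_normal_pow4 :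
  gamma.-integrable [set: R] (EFin \o (fun z : R => z ^+ 4)%R).
Proof.
have m4 : measurable_fun [set: R] (EFin \o (fun z : R => z ^+ 4)%R).
  by apply/measurable_EFinP; exact: measurable_funX.
apply/integrableP; split => //.
under eq_integral => z _ do rewrite /= ger0_norm ?exprn_even_ge0//.
have p0 z : 0 <= (z ^+ 4 : R)%:E by rewrite lee_fin exprn_even_ge0.
rewrite (ge0_integral_normalR_pdf 0 1 m4 p0).
(* Comparison with the density of deviation 2: the quotient of the densities is
   [2 exp (- 3 z^2 / 8)], and [exp (3 z^2 / 8) >= (3 z^2 / 16)^2]. Hence [58 = 2 * 29], where 29 is
   the least integer with [29 * 9 / 256 >= 1]. *)
apply: (@le_lt_trans _ _ (\int[mu]_x (58%:E * (normal_pdf 0 2 x)%:E))).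
  apply: ge0_le_integral => //.
  - by move=> z _; rewrite mule_ge0 ?p0// lee_fin normal_pdf_ge0.
  - by apply: emeasurable_funM => //; apply/measurable_EFinP; exact: measurable_normal_pdf.
  - by apply: emeasurable_funM => //; apply/measurable_EFinP; exact: measurable_normal_pdf.
  move=> z _; rewrite -!EFinM lee_fin !normal_pdf_gt0E// !subr0 !invr1 mul1r mulr1.
  set p := (Num.sqrt _)^-1%R.
  have pp : (0 <= p)%R by rewrite invr_ge0 sqrtr_ge0.
  have -> : (- z ^+ 2 / 2 = - (z / 2) ^+ 2 / 2 - 3 / 8 * z ^+ 2)%R by field.
  rewrite expRD expRN.
  set e := expR (- (z / 2) ^+ 2 / 2); set E := expR (3 / 8 * _).
  have e0 : (0 <= e)%R by exact: expR_ge0.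
  have E0 : (0 < E)%R by exact: expR_gt0.
  rewrite (_ : 58 * (2^-1 * p * e) = (29 * (p * e)))%R; last by field.
  rewrite (_ : z ^+ 4 * (p * (e / E)) = (z ^+ 4 / E) * (p * e))%R; last by ring.
  apply: ler_wpM2r; first exact: mulr_ge0.
  rewrite ler_pdivrMr//.
  have -> : E = (expR (3 / 16 * z ^+ 2) ^+ 2)%R.
    by rewrite -expRM_natl; congr expR; field.
  have h : (3 / 16 * z ^+ 2 <= expR (3 / 16 * z ^+ 2))%R.
    by rewrite (le_trans _ (expR_ge1Dx _))// lerDr.
  have h0 : (0 <= 3 / 16 * z ^+ 2)%R by rewrite mulr_ge0 ?sqr_ge0.
  have := lerXn2r 2 h0 (expR_ge0 _) h.
  set X := (expR _ ^+ 2)%R => hX.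
  rewrite (@le_trans _ _ (29 * (3 / 16 * z ^+ 2) ^+ 2)%R)//; last by rewrite ler_pM2l.
  rewrite (_ : 29 * _ = (29 * 9 / 256) * z ^+ 4)%R; last by field.
  have z4 : (0 <= z ^+ 4)%R by rewrite exprn_even_ge0.
  by lra.
have mp : measurable_fun [set: R] (fun x => (normal_pdf 0 2 x)%:E).
  by apply/measurable_EFinP; exact: measurable_normal_pdf.
rewrite (ge0_integralZl mu measurableT mp) ?integral_normal_pdf ?mule1 ?ltry//.
by move=> x _; rewrite lee_fin normal_pdf_ge0.
Qed.

(** By symmetry the positive and negative parts have equal integrals; these are finite, so they
    cancel. *)
Lemma integral_normal_id : \int[gamma]_x x%:E = 0.
Proof.
have mi : measurable_fun [set: R] (EFin : R -> \bar R) by exact/measurable_EFinP.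
have mid : measurable_fun [set: R] (fun x : R => x) by [].
have ii : gamma.-integrable [set: R] (EFin : R -> \bar R).
  have := integrable_pow_le4 mid integrable_normal_pow4 (isT : (1 <= 4)%N).
  by apply: eq_integrable => // x _ /=; rewrite expr1.
have f1 := integrable_pos_fin_num measurableT ii.
rewrite integralE.
have -> : \int[gamma]_x ((EFin : R -> \bar R)^\- x) = \int[gamma]_x ((EFin : R -> \bar R)^\+ x).
  rewrite -(ge0_integral_normalRN (measurable_funepos mi) (fun x => funepos_ge0 _ _)).
  by apply: eq_integral => x _; rewrite funenegE funeposE EFinN.
by rewrite subee.
Qed.

(* With [s = (1 + h)^(-1/2)], completing the square gives
   [E (exp (- h Z^2 / 2)) = s]; then [exp x >= 1 + x] bounds [E Z^2] on both
   sides, according to the sign of [h]. *)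
Lemma integral_normal_sqr : \int[gamma]_x (x ^+ 2)%:E = 1.
Proof.
have mid : measurable_fun [set: R] (fun x : R => x) by [].
have i2 := integrable_pow_le4 mid integrable_normal_pow4 (isT : (2 <= 4)%N).
have v_fin := integrable_fin_num measurableT i2.
set v := \int[gamma]_x _.
have {}v_fin : v \is a fin_num by [].
rewrite -(fineK v_fin); congr EFin; set V := fine v.
have key (s : R) : (0 < s)%R -> (1 - (s ^- 2 - 1) / 2 * V <= s)%R.
  move=> s0.
  pose e (x : R) := expR (- (s ^- 2 - 1) / 2 * x ^+ 2).
  have me : measurable_fun [set: R] (EFin \o e).
    apply/measurable_EFinP; apply: measurableT_comp => //.
    by apply: measurable_funM => //; exact: measurable_funX.
  have e0 x : 0 <= (e x)%:E by rewrite lee_fin expR_ge0.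
  have eE : \int[gamma]_x (e x)%:E = s%:E.
    rewrite (ge0_integral_normalR_pdf 0 1 me e0).
    have mp : measurable_fun [set: R] (fun x => (normal_pdf 0 s x)%:E).
      by apply/measurable_EFinP; exact: measurable_normal_pdf.
    have p0 x : [set: R] x -> 0 <= (normal_pdf 0 s x)%:E by rewrite lee_fin normal_pdf_ge0.
    have := ge0_integralZl mu measurableT mp (k := s%:E) p0.
    rewrite lee_fin ltW// => /(_ isT); rewrite integral_normal_pdf mule1 => <-.
    apply: eq_integral => x _; rewrite -!EFinM; congr EFin.
    rewrite !normal_pdf_gt0E// !subr0 !invr1 mul1r mulr1 /e.
    rewrite mulrCA -expRD -!mulrA mulVKf ?gt_eqF//; congr (_ * expR _)%R.
    by field; rewrite gt_eqF.
  have ie : gamma.-integrable [set: R] (EFin \o e).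
    apply/integrableP; split => //.
    have -> : \int[gamma]_x `|(EFin \o e) x| = s%:E; last by rewrite ltry.
    by rewrite -eE; apply: eq_integral => x _; exact: (gee0_abs (e0 x)).
  rewrite -lee_fin -eE EFinB EFinM fineK// -/v.
  have i1 : gamma.-integrable [set: R] (EFin \o cst 1%R).
    exact: finite_measure_integrable_cst.
  have i3 : gamma.-integrable [set: R] (fun x : R => ((s ^- 2 - 1) / 2)%:E * (x ^+ 2)%:E).
    exact: integrableZl.
  have -> : 1 = \int[gamma]_x (EFin \o cst 1%R) x.
    transitivity (\int[gamma]_x (cst 1 x)); last exact: eq_integral.
    by rewrite integral_cst// [X in _ * X](@probability_setT _ _ _ gamma) mule1.
  rewrite -(integralZl measurableT i2) -(integralB measurableT i1 i3).
  apply: le_integral => //; first exact: integrableB.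
  move=> x _ /=; rewrite lee_fin (le_trans _ (expR_ge1Dx _))//.
  by rewrite /e -!mulNr.
have {}key (s : R) : (0 < s)%R -> ((1 - s) * (2 * s ^+ 2) <= (1 - s) * ((1 + s) * V))%R.
  move=> s0; have := key s s0.
  rewrite -(ler_pM2r (_ : 0 < 2 * s ^+ 2)%R) ?mulr_gt0 ?exprn_gt0//.
  have -> : ((1 - (s ^- 2 - 1) / 2 * V) * (2 * s ^+ 2) = 2 * s ^+ 2 - (1 - s) * ((1 + s) * V))%R.
    by field; rewrite gt_eqF.
  by move=> h; lra.
apply/eqP; rewrite eq_le; apply/andP; split.
  (* The value [s = 1 + e / 2] gives [V <= 2 s^2 / (1 + s) <= 1 + e]. The lower bound uses
     [s = 1 - e / 2]; the case [e >= 1], where [V >= 0] suffices, is set apart to keep [s]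
     positive. *)
  apply/ler_addgt0Pr => e e0.
  have := key (1 + e / 2)%R; rewrite addr_gt0 ?divr_gt0// => /(_ isT).
  have -> : (1 - (1 + e / 2) = - (e / 2))%R by ring.
  rewrite !mulNr lerN2 ler_pM2l ?divr_gt0// => h.
  have : (2 * (1 + e / 2) ^+ 2 <= (1 + (1 + e / 2)) * (1 + e))%R by nra.
  move=> /(le_trans h); rewrite ler_pM2l//.
  by rewrite !addr_gt0 ?divr_gt0.
apply/ler_addgt0Pr => e e0.
have [e1|e1] := leP 1%R e.
  have V0 : (0 <= V)%R by apply: fine_ge0; apply: integral_ge0 => x _; rewrite lee_fin sqr_ge0.
  by rewrite (le_trans e1)// lerDr.
have := key (1 - e / 2)%R.
have s0 : (0 < 1 - e / 2)%R by lra.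
rewrite s0 => /(_ isT).
have -> : (1 - (1 - e / 2) = e / 2)%R by ring.
rewrite ler_pM2l ?divr_gt0// => h.
have : ((1 + (1 - e / 2)) * (1 - e) <= 2 * (1 - e / 2) ^+ 2)%R by nra.
move=> h2; have := le_trans h2 h; rewrite ler_pM2l; first by lra.
by lra.
Qed.

(** The density is at most its peak. With [r = 0] this shows that a point is null; with small [r] it
    controls the negative moment below. *)
Lemma normal_prob_itv_le (r : R) : (0 <= r)%R ->
  gamma `[(- r)%R, r]%classic <= (2 * normal_peak 1 * r)%:E.
Proof.
move=> r0; rewrite normalRE /normal_prob.
apply: (@le_trans _ _ (\int[mu]_(x in `[(- r)%R, r]) (normal_peak 1)%:E)).
  apply: ge0_le_integral => //.
  - by move=> x _; rewrite lee_fin normal_pdf_ge0.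
  - by apply: measurable_funTS; apply/measurable_EFinP; exact: measurable_normal_pdf.
  - by move=> x _; rewrite lee_fin normal_pdf_ub ?oner_eq0.
rewrite integral_cst//= lebesgue_measure_itv/= lte_fin.
case: ifPn => _; last by rewrite mule0 lee_fin !mulr_ge0 ?normal_peak_ge0.
by rewrite -EFinD -EFinM lee_fin (_ : _ * (r - - r) = 2 * normal_peak 1 * r)%R; last by ring.
Qed.

Lemma measurable_inv_sqrt :
  measurable_fun [set: R] (fun x : R => (Num.sqrt `|x|)^-1)%R.
Proof.
rewrite (_ : (fun x => _) = (fun x => Num.sqrt `|x| `^ (-1))%R); last first.
  by apply/funext => x; rewrite powR_inv1 ?sqrtr_ge0.
apply: (measurableT_comp (@measurable_powR R (-1)%R)).
apply: (measurableT_comp (continuous_measurable_fun (@sqrt_continuous R))).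
exact: normr_measurable.
Qed.

(** Layer-cake bound: [Y] is at most the sum over [n] of the indicators of [Y > n], and [Y > n]
    forces [|x| < n^(-2)], an event of probability [O(n^(-2))]. *)
Lemma integral_normal_inv_sqrt_lty :
  \int[gamma]_x ((Num.sqrt `|x|)^-1)%:E < +oo.
Proof.
pose Y (x : R) : R := ((Num.sqrt `|x|)^-1)%R.
have mY : measurable_fun [set: R] Y by exact: measurable_inv_sqrt.
have Y0 x : (0 <= Y x)%R by rewrite invr_ge0 sqrtr_ge0.
pose A n := [set x : R | (n%:R < Y x)%R].
have mA n : measurable (A n).
  rewrite (_ : A n = Y @^-1` `]n%:R, +oo[%classic); last first.
    by apply/seteqP; split => x /=; rewrite in_itv/= andbT.
  by rewrite -[X in measurable X]setTI; exact: mY.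
have mI n : measurable_fun [set: R] (fun x => (\1_(A n) x)%:E : \bar R).
  by apply/measurable_EFinP; exact: measurable_indic.
apply: (@le_lt_trans _ _ (\int[gamma]_x \sum_(n <oo) (\1_(A n) x)%:E)).
  apply: ge0_le_integral => //.
  - exact/measurable_EFinP.
  - by apply: ge0_emeasurable_sum => // n x _ _; rewrite lee_fin.
  move=> x _.
  (* [N] is the least natural number above [Y x], so the indicators of index below [N] are all 1. *)
  have [N NY] : exists N : nat, (Y x <= N%:R)%R /\ forall n, (n < N)%N -> (n%:R < Y x)%R.
    have exN : exists N : nat, (Y x <= N%:R)%R.
      by exists (Num.truncn (Y x)).+1; rewrite ltW// truncnS_gt.
    case: (ex_minnP exN) => N YN Nmin; exists N; split => // n nN.
    by rewrite ltNge; apply/negP => /Nmin; rewrite leqNgt nN.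
  apply: (@le_trans _ _ (\sum_(0 <= n < N) (\1_(A n) x)%:E)); last first.
    by apply: nneseries_lim_ge => n _ _; rewrite lee_fin.
  rewrite sumEFin lee_fin (le_trans NY.1)//.
  rewrite (eq_big_nat _ _ (F2 := fun=> 1%R)); first by rewrite sumr_const_nat subn0.
  by move=> n /andP[_ nN]; rewrite indicE mem_set//; exact: NY.2.
rewrite integral_nneseries//.
under eq_eseriesr do rewrite integral_indic// setIT.
(* The term [n = 0], for which [n^(-2)] gives no bound, is split off and bounded by 1. *)
rewrite nneseries_recl// -nneseries_addn//.
under eq_eseriesr do rewrite addn1.
apply: lte_add_pinfty.
  by rewrite (le_lt_trans (probability_le1 _ _))// ltry.
apply: (@le_lt_trans _ _ (\sum_(n <oo) ((2 * normal_peak 1)%:E * (n.+1%:R ^- 2)%:E))).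
  apply: lee_nneseries => [n _ _|n _]; first exact: measure_ge0.
  have n0 : (0 < n.+1%:R ^+ 2 :> R)%R by rewrite exprn_gt0.
  apply: (@le_trans _ _ (gamma `[(- (n.+1%:R ^- 2))%R, (n.+1%:R ^- 2)%R]%classic)); last first.
    by apply: normal_prob_itv_le; rewrite invr_ge0 ltW.
  apply: le_measure; rewrite ?inE//= => x; rewrite /A/= /Y in_itv/= -ler_norml => nY.
  have x0 : (0 < Num.sqrt `|x|)%R.
    by rewrite -invr_gt0 (lt_trans _ nY).
  have : (Num.sqrt `|x| < n.+1%:R^-1)%R by rewrite -[ltLHS]invrK ltf_pV2 ?posrE ?invr_gt0.
  move=> h; rewrite -(sqr_sqrtr (normr_ge0 x)) -exprVn.
  by apply: lerXn2r; rewrite ?nnegrE ?sqrtr_ge0 ?invr_ge0// ltW.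
rewrite nneseriesZl//.
by rewrite lte_mul_pinfty// ?nneseries_inv_sqr_lty// lee_fin mulr_ge0// normal_peak_ge0.
Qed.

End normal_moments.

(** * Layers driven by Gaussian matrices *)

Lemma ge0_integral_law d (T : measurableType d) (R : realType)
    (P : probability T R) (nu : probability R R) (X : T -> R) (f : R -> \bar R) :
  measurable_fun setT X -> (forall B, measurable B -> P (X @^-1` B) = nu B) ->
  measurable_fun setT f -> (forall x, 0 <= f x)%E ->
  (\int[P]_w f (X w) = \int[nu]_x f x)%E.
Proof.
move=> mX lX mf f0.
have := ge0_integral_pushforward mX P measurableT mf (fun y _ => f0 y).
rewrite preimage_setT => /= <-.
by apply: eq_measure_integral => A mA _; exact: lX.
Qed.

Lemma sqnorm_ge0 (R : realType) d (v : 'cV[R]_d) : 0 <= sqnorm v.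
Proof. by apply: sumr_ge0 => i _; exact: sqr_ge0. Qed.

Lemma sqnorm_eq0 (R : realType) d (v : 'cV[R]_d) : (sqnorm v == 0) = (v == 0).
Proof.
apply/eqP/eqP => [|->]; last by rewrite /sqnorm big1// => i _; rewrite mxE expr0n.
move=> v0; apply/matrixP => i j; rewrite ord1 mxE; apply/eqP.
rewrite -sqrf_eq0; apply/eqP; move: i {j} isT.
by apply/psumr_eq0P => // i _; exact: sqr_ge0.
Qed.

Lemma prelu_eq0 (R : realType) (a z : R) : 0 < a ->
  (prelu a z == 0) = (z == 0).
Proof.
by move=> a0; rewrite /prelu; case: ifPn => // _; rewrite mulf_eq0 gt_eqF.
Qed.

Section layers.
Context dT (T : measurableType dT) (R : realType) (P : probability T R)
  (d : nat) (sigma a : R) (x0 : 'cV[R]_d) (W : nat -> T -> 'M[R]_d).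
Local Notation X := (fun p : nat * ('I_d * 'I_d) => fun w => W p.1 w p.2.1 p.2.2).
Local Notation S k := [set p : nat * ('I_d * 'I_d) | (p.1 < k)%N].
Local Notation x k w := (layer a (W ^~ w) x0 k).
Local Notation gamma := (normalR (0 : R) 1).
Hypothesis sigma0 : 0 < sigma.
Hypothesis iW : mutually_independent P X.
Hypothesis lW : forall k i j, has_normal_law P sigma (fun w => W k w i j).

Lemma layerSE k w i :
  x k.+1 w i ord0 = prelu a (\sum_(j < d) W k w i j * x k w j ord0).
Proof. by rewrite /= !mxE. Qed.

(** Adaptedness: [x^(k)] involves [W 0], ..., [W k.-1] only, so the matrix [W k] of the next layer
    is fresh. *)
Lemma measurable_layer k i :
  measurable_fun setT ((fun w => x k w i ord0) : history X (S k) -> R).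
Proof.
elim: k i => [|k IH] i; first exact: measurable_cst.
have SS : S k `<=` S k.+1 by move=> p /= /ltn_trans; apply.
have mH := history_sub (X := X) SS.
rewrite (_ : (fun w => _) = fun w => prelu a (\sum_(j < d) X (k, (i, j)) w * x k w j ord0)); last first.
  by apply/funext => w; exact: layerSE.
apply: (measurableT_comp (@measurable_prelu R a)).
apply: (@measurable_sum _ (history X (S k.+1))) => j.
apply: measurable_funM; last exact: measurableT_comp (IH j) mH.
exact: (@measurable_history _ _ _ _ X (S k.+1) (k, (i, j)) (ltnSn k)).
Qed.

Lemma measurable_sqnorm_layer k : measurable_fun setT (fun w => sqnorm (x k w)).
Proof.
have [mX _] := iW.
have mid := @measurable_id_history _ _ _ _ X (S k) mX.
apply: measurable_sum => i; apply: measurable_funX.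
exact: (measurableT_comp (@measurable_layer k i) mid).
Qed.

Let lX p B : measurable B -> P (X p @^-1` B) = normalR 0 sigma B.
Proof. by move=> mB; exact: lW. Qed.

Let nuE f : measurable_fun [set: R] f -> (forall x, 0 <= f x)%E ->
  (\int[normalR 0 sigma]_x f x = \int[gamma]_x f (sigma * x)%R)%E.
Proof. by move=> mf f0; exact: ge0_integral_normalRZ. Qed.

(** If [x^(k)] is nonzero, a pre-activation of the next layer is Gaussian with positive variance,
    hence almost surely nonzero, and [prelu a] with [a > 0] vanishes only at 0. So the probability
    of a zero layer never grows with [k]. *)
Lemma layer_neq0_ae : (0 < d)%N -> 0 < a -> x0 != 0 ->
  {ae P, forall w, forall k, x k w != 0}.
Proof.
move=> d0 a0 x00; pose E k := [set w | sqnorm (x k w) = 0].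
have mE k : measurable (E k).
  rewrite (_ : E k = (fun w => sqnorm (x k w)) @^-1` [set 0])//.
  by rewrite -[X in measurable X]setTI; exact: measurable_sqnorm_layer.
pose i0 := Ordinal d0.
have gamma0 : gamma [set 0] = 0%E.
  apply/eqP; rewrite eq_le measure_ge0 andbT.
  have := @normal_prob_itv_le R 0 (lexx _).
  by rewrite mulr0 oppr0 set_itv1.
have PE k : P (E k) = (\int[P]_w (\1_(E k) w)%:E)%E by rewrite integral_indic// setIT.
have gE : gamma [set 0] = (\int[gamma]_z (\1_[set (0 : R)] z)%:E)%E.
  by rewrite integral_indic// setIT.
have E0 k : P (E k) = 0%E.
  elim: k => [|k IH].
    rewrite (_ : E 0%N = set0) ?measure0//; apply/seteqP; split => w //=.
    by move/eqP; rewrite sqnorm_eq0 (negbTE x00).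
  have mI0 : measurable_fun [set: R] (fun v => (\1_[set (0 : R)] v)%:E : \bar R).
    by apply/measurable_EFinP; exact: measurable_indic.
  pose y w := \sum_(j < d) X (k, (i0, j)) w * x k w j ord0.
  apply/eqP; rewrite eq_le measure_ge0 andbT.
  rewrite PE.
  (* A zero output forces the pre-activation [y] of the single coordinate [i0] to be zero. *)
  apply: (@le_trans _ _ (\int[P]_w (\1_[set (0 : R)] (y w))%:E))%E.
    apply: ge0_le_integral => //.
    - by apply/measurable_EFinP; exact: measurable_indic.
    - apply: (measurableT_comp mI0).
      apply: measurable_sum => j; apply: measurable_funM; first exact: iW.1.
      have mid := @measurable_id_history _ _ _ _ X (S k) iW.1.
      exact: (measurableT_comp (@measurable_layer k j) mid).
    move=> w _; rewrite lee_fin !indicE ler_nat.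
    case: (boolP (w \in E k.+1)) => // /set_mem /eqP; rewrite sqnorm_eq0 => /eqP x0E.
    suff : y w = 0 by move=> ->; rewrite mem_set.
    apply/eqP; rewrite -(prelu_eq0 (y w) a0) -layerSE x0E mxE.
    by [].
  have r2E w : \sum_(j < d) x k w j ord0 ^+ 2 = sqnorm (x k w) by [].
  have rowE := @ge0_integral_row _ T R P _ X (normalR 0 sigma) gamma sigma iW lX
    (ltW sigma0) nuE (@ge0_integral_normalRD R) 'I_d (index_enum _) (S k)
    (fun j => (k, (i0, j))) (fun j w => x k w j ord0)
    (fun p => (\1_[set (0 : R)] p.2)%:E).
  rewrite {}rowE.
  (* Given the past, [y = 0] has probability 1 where [x^(k) = 0] and probability 0 elsewhere, so the
     integral is exactly [P (E k)]. *)
  - rewrite -[leRHS]IH PE.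
    rewrite le_eqVlt; apply/orP; left; apply/eqP.
    apply: eq_integral => w _; rewrite /= r2E.
    have [q0|q0] := eqVneq (sqnorm (x k w)) 0.
      rewrite q0 sqrtr0 mulr0 indicE mem_set//.
      under eq_integral do rewrite mul0r indicE mem_set//.
      by rewrite integral_cst// [X in (_ * X)%E]probability_setT mule1.
    rewrite indicE memNset; last by move=> /eqP; rewrite (negbTE q0).
    have s0 : sigma * Num.sqrt (sqnorm (x k w)) != 0.
      by rewrite mulf_neq0 ?gt_eqF// sqrtr_gt0 lt_neqAle eq_sym q0 sqnorm_ge0.
    rewrite -[RHS]gamma0 gE.
    apply: eq_integral => z _; rewrite !indicE; congr ((nat_of_bool _)%:R%:E).
    by apply/idP/idP => /set_mem /eqP /= h; apply/mem_set/eqP; move: h; rewrite /= mulf_eq0 (negbTE s0).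
  - exact: index_enum_uniq.
  - by move=> i j _ _ [].
  - by move=> j _ /=; rewrite ltnn.
  - by move=> j; exact: measurable_layer.
  - exact: (measurableT_comp mI0 (@measurable_snd _ _ (history X (S k)) R)).
  - by move=> z; rewrite lee_fin.
have : P.-negligible (\bigcup_k E k).
  by apply: negligible_bigcup => k; exists (E k); split => //; exact: E0.
apply: negligibleS => w /= /existsNP[k /negP]; rewrite negbK => /eqP xk0.
by exists k => //; rewrite /E/=; apply/eqP; rewrite sqnorm_eq0 xk0.
Qed.

Section step.
Context dT' (T' : measurableType dT') (P' : probability T' R)
  (Z : 'I_d -> T' -> R).
Hypothesis iZ : mutually_independent P' Z.
Hypothesis lZ : forall i, has_normal_law P' 1 (Z i).
Local Notation Q w := (sqnorm (map_mx (prelu a) (\col_i Z i w))).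

Lemma sqnorm_preluE w : Q w = \sum_(i < d) prelu a (Z i w) ^+ 2.
Proof. by apply: eq_bigr => i _; rewrite !mxE. Qed.

Lemma measurable_sqnorm_prelu : measurable_fun setT (fun w => Q w).
Proof.
under eq_fun do rewrite sqnorm_preluE.
apply: measurable_sum => i; apply: measurable_funX.
exact: (measurableT_comp (@measurable_prelu R a) (iZ.1 i)).
Qed.

Lemma ge0_integral_layerS k (G : R -> \bar R) :
  measurable_fun setT G -> (forall q, 0 <= G q)%E ->
  (\int[P]_w G (sqnorm (x k.+1 w)) =
   \int[P]_w \int[P']_w' G (sigma ^+ 2 * sqnorm (x k w) * Q w')%R)%E.
Proof.
move=> mG G0.
have := @ge0_integral_rows _ T R P _ T' P' _ 'I_d 'I_d X Z (normalR 0 sigma) gamma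
  sigma a iW lX iZ (fun i B mB => lZ i mB) (ltW sigma0) nuE (@ge0_integral_normalRD R)
  (index_enum _) (index_enum _) (S k) (fun p => (k, p)) (fun j w => x k w j ord0)
  (fun p => G p.2) (index_enum_uniq _) (index_enum_uniq _).
move=> /(_ _ _ (@measurable_layer k) _ (fun z => G0 z.2)) H.
transitivity (\int[P]_w G (\sum_(i < d)
    prelu a (\sum_(j < d) X (k, (i, j)) w * x k w j ord0) ^+ 2)%R)%E.
  by apply: eq_integral => w _; congr (G _); apply: eq_bigr => i _; rewrite layerSE.
rewrite H.
- by apply: eq_integral => w _; apply: eq_integral => w' _; rewrite sqnorm_preluE.
- by move=> [i j] [i' j'] [-> ->].
- by move=> i j _ /=; rewrite ltnn.
- exact: (measurableT_comp mG (@measurable_snd _ _ (history X (S k)) R)).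
Qed.

End step.
End layers.

(* [u <= e^u] applied at [u / 4] and [- u / 16]. *)
Lemma pow4_le_expR (R : realType) (u : R) :
  u ^+ 4 <= 4 ^+ 4 * expR u + 16 ^+ 4 * expR (- u / 4).
Proof.
have key (v c : R) : 0 <= v -> 0 < c -> v ^+ 4 <= c ^+ 4 * expR (v / c) ^+ 4.
  move=> v0 c0; rewrite -exprMn; apply: lerXn2r; rewrite ?nnegrE//.
    by rewrite mulr_ge0 ?expR_ge0// ltW.
  rewrite -ler_pdivrMl// mulrC (le_trans _ (expR_ge1Dx _))// lerDr.
  exact: ler01.
have [u0|u0] := leP 0 u.
  apply: (@le_trans _ _ (4 ^+ 4 * expR u)); last by rewrite lerDl mulr_ge0 ?expR_ge0.
  have -> : expR u = expR (u / 4) ^+ 4 by rewrite -expRM_natl; congr expR; field.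
  exact: key.
apply: (@le_trans _ _ (16 ^+ 4 * expR (- u / 4))); last by rewrite lerDr mulr_ge0 ?expR_ge0.
have -> : expR (- u / 4) = expR (- u / 16) ^+ 4 by rewrite -expRM_natl; congr expR; field.
have -> : u ^+ 4 = (- u) ^+ 4 by ring.
by apply: key => //; rewrite oppr_ge0 ltW.
Qed.

(** * Fourth moment of the logarithm of the squared norm *)

Section log_moments.
Context (R : realType) (d : nat) (a : R) dT' (T' : measurableType dT')
  (P' : probability T' R) (Z : 'I_d -> T' -> R).
Hypothesis d0 : (0 < d)%N.
Hypothesis a01 : 0 < a <= 1.
Hypothesis iZ : mutually_independent P' Z.
Hypothesis lZ : forall i, has_normal_law P' 1 (Z i).
Local Notation gamma := (normalR (0 : R) 1).
Local Notation Q w := (sqnorm (map_mx (prelu a) (\col_i Z i w))).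

Let a0 : 0 < a. Proof. by case/andP: a01. Qed.
Let i0 := Ordinal d0.

Lemma prelu_sqr_le z : prelu a z ^+ 2 <= z ^+ 2.
Proof.
rewrite /prelu; case: ifP => // _; rewrite exprMn ler_piMl ?sqr_ge0//.
by apply: exprn_ile1; [exact: ltW|case/andP: a01].
Qed.

Lemma le_prelu_sqr z : (a * z) ^+ 2 <= prelu a z ^+ 2.
Proof.
rewrite /prelu; case: ifP => // _; rewrite exprMn ler_piMl ?sqr_ge0//.
by apply: exprn_ile1; [exact: ltW|case/andP: a01].
Qed.

Let lawE i f : measurable_fun [set: R] f -> (forall x, 0 <= f x)%E ->
  (\int[P']_w f (Z i w) = \int[gamma]_x f x)%E.
Proof. by move=> mf f0; exact: (@ge0_integral_law _ _ _ P' gamma (Z i) f (iZ.1 i) (fun B mB => lZ i mB)). Qed.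

Lemma prelu_normal_neq0_ae : {ae P', forall w, Z i0 w != 0}.
Proof.
exists (Z i0 @^-1` [set 0]); split => //.
- by rewrite -[X in measurable X]setTI; exact: iZ.1.
- apply/eqP; rewrite eq_le measure_ge0 andbT lZ//.
  by have := @normal_prob_itv_le R 0 (lexx _); rewrite mulr0 oppr0 set_itv1.
- by move=> w /= /negP; rewrite negbK => /eqP.
Qed.

Lemma sqnorm_prelu_gt0 w : Z i0 w != 0 -> 0 < Q w.
Proof.
move=> z0; rewrite lt_neqAle eq_sym sqnorm_ge0 andbT sqnorm_eq0.
apply: contra z0 => /eqP/matrixP/(_ i0 ord0); rewrite !mxE => /eqP.
by rewrite prelu_eq0.
Qed.

(** [pow4_le_expR] at [u = ln Q] gives [4^4 Q + 16^4 Q^(-1/4)]. The first term is bounded through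
    [Q <= sum_i (Z i)^2], the second through [Q >= (a * Z i0)^2], that is,
    [Q^(-1/4) <= (a |Z i0|)^(-1/2)]. The exponent 1/4 keeps this integrable with a single
    coordinate. *)
Lemma integrable_ln_pow4 :
  P'.-integrable setT (EFin \o (fun w => ln (Q w) ^+ 4)).
Proof.
have mQ := measurable_sqnorm_prelu a iZ.
have mL : measurable_fun setT (EFin \o (fun w => ln (Q w) ^+ 4)).
  apply/measurable_EFinP; apply: measurable_funX.
  exact: (measurableT_comp (@measurable_ln R)).
have m2 : measurable_fun [set: R] (fun x : R => (x ^+ 2)%:E).
  by apply/measurable_EFinP; exact: measurable_funX.
pose Y (x : R) : R := (Num.sqrt `|x|)^-1.
have mY : measurable_fun [set: R] (EFin \o Y) by apply/measurable_EFinP; exact: measurable_inv_sqrt.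
have Y0 x : (0 <= (Y x)%:E)%E by rewrite lee_fin invr_ge0 sqrtr_ge0.
have s0 i w : (0 <= (Z i w ^+ 2)%:E)%E by rewrite lee_fin sqr_ge0.
pose c : R := 16 ^+ 4 * (Num.sqrt a)^-1.
have c0 : 0 <= c by rewrite mulr_ge0// invr_ge0 sqrtr_ge0.
have mZ2 i : measurable_fun setT (fun w => (Z i w ^+ 2)%:E).
  exact: (measurableT_comp m2 (iZ.1 i)).
have mZY : measurable_fun setT (fun w => (Y (Z i0 w))%:E).
  exact: (measurableT_comp mY (iZ.1 i0)).
pose F w := ((4 ^+ 4)%:E * \sum_(i < d) (Z i w ^+ 2)%:E + c%:E * (Y (Z i0 w))%:E)%E.
have sum0 w : (0 <= \sum_(i < d) (Z i w ^+ 2)%:E)%E by exact: sume_ge0.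
have msum : measurable_fun setT (fun w => \sum_(i < d) (Z i w ^+ 2)%:E)%E.
  exact: emeasurable_sum.
apply/integrableP; split => //.
apply: (@le_lt_trans _ _ (\int[P']_w F w)%E).
  apply: ae_ge0_le_integral => //.
  - exact: measurableT_comp.
  - by move=> w _; rewrite adde_ge0// mule_ge0.
  - by apply: emeasurable_funD; apply: emeasurable_funM.
  (* The comparison needs [expR (ln Q) = Q], hence [Q > 0], which holds only almost surely. *)
  apply: filterS prelu_normal_neq0_ae => w z0 _ /=.
  have q0 := sqnorm_prelu_gt0 z0.
  rewrite /F sumEFin -!EFinM -EFinD lee_fin ger0_norm ?exprn_even_ge0//.
  rewrite (le_trans (pow4_le_expR _))// lnK// lerD//.
    rewrite ler_pM2l ?exprn_gt0// sqnorm_preluE; apply: ler_sum => i _; exact: prelu_sqr_le.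
  rewrite /c -[leRHS]mulrA ler_pM2l ?exprn_gt0// -invfM -sqrtrM; last exact: ltW.
  set y := Num.sqrt (a * _).
  have y0 : 0 < y by rewrite sqrtr_gt0 mulr_gt0 ?normr_gt0.
  rewrite -[leRHS]lnK ?posrE ?invr_gt0// ler_expR lnV ?posrE//.
  rewrite mulNr lerN2 ler_pdivlMr// mulr_natr -lnXn//.
  rewrite ler_ln ?posrE ?exprn_gt0//.
  rewrite (_ : y ^+ 4 = (a * Z i0 w) ^+ 2); last first.
    rewrite (exprM _ 2 2) sqr_sqrtr; last by rewrite mulr_ge0// ltW.
    by rewrite !exprMn real_normK// num_real.
  rewrite sqnorm_preluE (bigD1 i0)//= (le_trans (le_prelu_sqr _))// lerDl.
  by apply: sumr_ge0 => i _; exact: sqr_ge0.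
rewrite ge0_integralD//; last 4 first.
- by move=> w _; rewrite mule_ge0.
- exact: emeasurable_funM.
- by move=> w _; rewrite mule_ge0.
- exact: emeasurable_funM.
rewrite !ge0_integralZl// ge0_integral_sum//.
have zi i : (\int[P']_w (Z i w ^+ 2)%:E = 1)%E.
  by rewrite (@lawE i (fun x => (x ^+ 2)%:E))// ?integral_normal_sqr// => z; rewrite lee_fin sqr_ge0.
under eq_bigr do rewrite zi.
apply: lte_add_pinfty.
  by rewrite sumEFin -EFinM ltry.
apply: lte_mul_pinfty => //.
rewrite (@lawE i0 (EFin \o Y))//.
exact: integral_normal_inv_sqrt_lty.
Qed.

End log_moments.

(** * Smooth approximation *)

Section smoothing.
Context {R : realType}.
Implicit Types (f df g F : R -> R) (x y t h : R).
Local Notation mu := (@lebesgue_measure R).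

(** Mean value theorem. The bound on [df] is asked only at points no farther from [x] than [y], so
    that [taylor3] can use bounds depending on that distance. *)
Lemma derive_bound f df (x y B : R) :
  (forall t, is_derive t 1 f (df t)) ->
  (forall t, `|t - x| <= `|y - x| -> `|df t| <= B) ->
  `|f y - f x| <= B * `|y - x|.
Proof.
move=> fdf dfB.
have fc (a b : R) : {within `[a, b], continuous f}.
  by apply: derivable_within_continuous => t _; have [] := fdf t.
have [xy|/ltW yx] := leP x y.
  have [c] := MVT_segment xy (fun t _ => fdf t) (@fc x y).
  rewrite in_itv/= => /andP[xc cy] ->; rewrite normrM ler_wpM2r// dfB//.
  by rewrite !ger0_norm ?subr_ge0// lerD2r.
have [c] := MVT_segment yx (fun t _ => fdf t) (@fc y x).
rewrite in_itv/= distrC (distrC y) => /andP[yc cx] ->.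
rewrite normrM ler_wpM2r// dfB//.
by rewrite distrC (distrC y) !ger0_norm ?subr_ge0// lerD2l lerN2.
Qed.

(** Makes integration from [-oo] an integration over a bounded interval, and passes to the
    antiderivative so obtained, so that the construction can be iterated. *)
Definition vanishing_left f := exists B, forall x, x <= B -> f x = 0.

Lemma antiderivative f : continuous f -> vanishing_left f ->
  exists F, [/\ forall x, is_derive x 1 F (f x), continuous F & vanishing_left F].
Proof.
move=> cf [B fB].
have intf u : mu.-integrable `]-oo, u] (EFin \o f).
  apply: (proj2 (@integrable_mkcond _ (measurableTypeR R) R mu _ (EFin \o f) (measurable_itv _))).
  have := @continuous_compact_integrable R f `[B, Num.max B u]%classic
    (@segment_compact R B _) (continuous_subspaceT cf).
  move/(proj1 (@integrable_mkcond _ (measurableTypeR R) R mu _ (EFin \o f) (measurable_itv _))).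
  apply: le_integrable => //.
    apply/(measurable_restrictT _ (measurable_itv _)).
    apply: measurable_funTS; apply/measurable_EFinP.
    exact: continuous_measurable_fun.
  move=> x _; rewrite !patchE; case: ifPn => [|_]; last by rewrite abse0 abse_ge0.
  rewrite inE/= in_itv/= => xu; have [xB|Bx] := leP x B; first by rewrite fB// normr0; exact: abse_ge0.
  by rewrite ifT// inE/= in_itv/= (ltW Bx) le_max xu orbT.
pose F x := (\int[mu]_(t in `]-oo, x]) f t)%R.
have dF x : is_derive x 1 F (f x).
  have x1 : x < x + 1 by rewrite ltrDl.
  have [dF FE] := @continuous_FTC1 R f -oo%O x (x + 1) x1 (intf _) (ltNyr _) (cf x).
  by apply: DeriveDef; [exact: dF|rewrite -derive1E; exact: FE].
exists F; split => //.
- move=> x; apply: differentiable_continuous; apply/derivable1_diffP.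
  by have [] := dF x.
- exists B => x xB; rewrite /F /Rintegral (eq_integral (cst 0%E)) ?integral0//.
  move=> t; rewrite inE/= in_itv/= => tx.
  by rewrite fB// (le_trans tx).
Qed.

(** When [F] is an antiderivative of [f], this is the Steklov average of [f] over [[x, x + h]]. *)
Definition dq h F x := (F (x + h) - F x) / h.

Lemma is_derive_dq h F f : (forall x, is_derive x 1 F (f x)) ->
  forall x, is_derive x 1 (dq h F) (dq h f x).
Proof.
move=> dF x.
have dS : is_derive x 1 (fun z : R => z + h) 1.
  by apply: is_derive_eq; rewrite addr0.
have dFS : is_derive x 1 (F \o (fun z : R => z + h)) (f (x + h)).
  have := @is_derive1_comp R F (fun z : R => z + h) x _ _ (dF (x + h)) dS.
  by rewrite mulr1.
rewrite (_ : dq h F = h^-1 *: ((F \o (fun z : R => z + h)) - F)); last first.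
  by apply/funext => z; rewrite /dq mulrC.
by apply: is_derive_eq; rewrite /dq mulrC.
Qed.

Lemma dq_mean h F f : 0 < h -> (forall x, is_derive x 1 F (f x)) ->
  forall x, exists2 t, 0 <= t <= h & dq h F x = f (x + t).
Proof.
move=> h0 dF x.
have xh : x <= x + h by rewrite lerDl ltW.
have [|c cx E] := MVT_segment xh (fun t _ => dF t).
  by apply: derivable_within_continuous => t _; have [] := dF t.
exists (c - x).
  by move: cx; rewrite in_itv/= => /andP[? ?]; apply/andP; split; lra.
by rewrite /dq E (addrC x h) addrK mulfK ?gt_eqF// addrC subrK.
Qed.

(** [derive_bound] is applied three times: to [g2], to the first-order remainder [r1] of [g1], and
    to the second-order remainder [r0] of [g], whose derivative is [r1]. The constant is [K] instead
    of [K / 6], which is enough. *)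
Lemma taylor3 (g g1 g2 g3 : R -> R) (K : R) :
  (forall x, is_derive x 1 g (g1 x)) -> (forall x, is_derive x 1 g1 (g2 x)) ->
  (forall x, is_derive x 1 g2 (g3 x)) -> (forall x, `|g3 x| <= K) ->
  forall x y, `|g (x + y) - g x - g1 x * y - g2 x * y ^+ 2 / 2| <= K * `|y| ^+ 3.
Proof.
move=> d0 d1 d2 g3K x y.
have b2 t : `|g2 t - g2 x| <= K * `|t - x|.
  by apply: (@derive_bound g2 g3) => // u _.
pose r1 t := g1 t - g1 x - g2 x * (t - x).
pose r0 t := g t - g x - g1 x * (t - x) - g2 x * (t - x) ^+ 2 / 2.
have dS t : is_derive t 1 (fun z : R => z - x) 1.
  by apply: is_derive_eq; rewrite subr0.
have dr1 t : is_derive t 1 r1 (g2 t - g2 x).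
  rewrite (_ : r1 = g1 - cst (g1 x) - (g2 x *: (fun z : R => z - x)))//.
  by apply: is_derive_eq; rewrite subr0 scaler1.
have dr0 t : is_derive t 1 r0 (r1 t).
  rewrite (_ : r0 = g - cst (g x) - (g1 x *: (fun z : R => z - x)) -
     (g2 x / 2) *: ((fun z : R => z - x) ^+ 2)); last first.
    by apply/funext => z; rewrite /r0 !fctE mulrAC.
  apply: is_derive_eq; rewrite /r1 /GRing.scale/=.
  by field.
have r1x : r1 x = 0 by rewrite /r1; ring.
have r0x : r0 x = 0 by rewrite /r0; ring.
have K0 : 0 <= K by exact: le_trans (g3K 0).
have b1 t : `|r1 t| <= K * `|t - x| ^+ 2.
  have := @derive_bound r1 (fun t => g2 t - g2 x) x t (K * `|t - x|) dr1.
  rewrite r1x subr0 expr2 mulrA; apply => u ux.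
  by rewrite (le_trans (b2 u))// ler_wpM2l.
have := @derive_bound r0 r1 x (x + y) (K * `|y| ^+ 2) dr0.
rewrite r0x subr0 (addrC x y) addrK -mulrA -exprSr => H.
have E : r0 (y + x) = g (y + x) - g x - g1 x * y - g2 x * y ^+ 2 / 2.
  by rewrite /r0; ring.
rewrite -E; apply: H => t tx.
by rewrite (le_trans (b1 t))// ler_wpM2l// lerXn2r.
Qed.

Lemma Heine_segment f (a b e : R) : continuous f -> 0 < e ->
  exists2 r, 0 < r & forall x y, a <= x <= b -> `|x - y| < r -> `|f x - f y| < e.
Proof.
move=> cf e0.
pose Q (r x : R) := forall y, `|x - y| < r -> `|f x - f y| < e.
have : \forall r \near (0 : R)^'+, `[a, b]%classic `<=` Q r.
  apply: (proj1 (compact_near_coveringP _) (@segment_compact R a b)) => x _.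
  have /cvgrPdist_lt/(_ (e / 2)) := cf x.
  rewrite divr_gt0// => /(_ isT)/nbhs_ballP[r /= r0 rf].
  exists (ball x (r / 2), [set r' | r' < r / 2]).
    split; first by apply: nbhsx_ballx; rewrite divr_gt0.
    by apply: nbhs_right_lt; rewrite divr_gt0.
  move=> [x' r'] /= [xx' r'r] y x'y.
  have r20 : r / 2 <= r by rewrite ler_pdivrMr// ler_peMr ?ltW// ltr1n.
  have h1 : `|f x - f x'| < e / 2 by apply: rf; exact: (lt_le_trans xx').
  have h2 : `|f x - f y| < e / 2.
    apply: rf; rewrite /ball/=; move: xx'; rewrite /ball/= => xx'.
    rewrite (splitr r) (le_lt_trans (ler_distD x' x y))// ltrD//.
    exact: lt_trans r'r.
  rewrite (splitr e) (le_lt_trans (ler_distD (f x) _ _))// ltrD//.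
  by rewrite distrC.
move=> H; near (0 : R)^'+ => r; exists r.
  by near: r; exact: nbhs_right_gt.
move=> x y xab xy.
have : `[a, b]%classic `<=` Q r by near: r.
by apply => //=; rewrite in_itv.
Unshelve. all: by end_near. Qed.

(** The argument of [f] is clamped to [[-N, N]], and the result is averaged three times over windows
    of length [h], that is, [dq h] is applied three times to a threefold antiderivative. Near the
    origin uniform continuity gives the error [e]; beyond [N] the crude bound [2 M] is below
    [e x^2]. *)
Lemma smooth_approx f (M e : R) : continuous f -> (forall x, `|f x| <= M) ->
  0 < e -> exists (g g1 g2 : R -> R) (C : R),
  [/\ continuous g, forall x, `|g x| <= C,
      forall x y, `|g x - g y| <= C * `|x - y|,
      forall x y, `|g (x + y) - g x - g1 x * y - g2 x * y ^+ 2 / 2| <= C * `|y| ^+ 3 &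
      forall x, `|f x - g x| <= e * (1 + x ^+ 2)].
Proof.
move=> cf fM e0.
have M0 : 0 <= M by exact: le_trans (fM 0).
have [N N0 NM] : exists2 N : R, 0 < N & 2 * M <= e * N ^+ 2.
  (* Chosen so that [N >= 1] and [e N >= 2 M], hence [e N^2 >= 2 M]. *)
  pose N := 1 + 2 * M / e.
  have N1 : 1 <= N by rewrite lerDl divr_ge0 ?mulr_ge0// ltW.
  exists N; first exact: lt_le_trans N1.
  apply: (@le_trans _ _ (e * N)).
    by rewrite /N mulrDr mulr1 (mulrC e) divfK ?gt_eqF// lerDr ltW.
  by rewrite ler_pM2l// expr2 ler_peMr// (le_trans _ N1).
pose cl x := Num.max (- N) (Num.min N x).
have clN x : - N <= cl x <= N.
  by rewrite /cl le_max lexx/= ge_max ge_min lexx /= andbT; lra.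
have cl_id x : `|x| <= N -> cl x = x.
  by rewrite ler_norml => /andP[? ?]; rewrite /cl min_r// max_r//.
have clE x : [\/ x <= - N /\ cl x = - N, - N <= x <= N /\ cl x = x | N <= x /\ cl x = N].
  have [Nx|xN] := leP N x.
    by apply: Or33; split => //; rewrite /cl min_l// max_r//; lra.
  have [xN'|Nx] := leP x (- N).
    by apply: Or31; split => //; rewrite /cl min_r ?(ltW xN)// max_l.
  apply: Or32; split; first lra.
  by apply: cl_id; rewrite ler_norml; lra.
have cl_lip x y : `|cl x - cl y| <= `|x - y|.
  have p1 := ler_norm (x - y); have p2 := ler_norm (y - x).
  rewrite (distrC y) in p2; rewrite ler_norml.
  by have [[? ->]|[? ->]|[? ->]] := clE x; have [[? ->]|[? ->]|[? ->]] := clE y; lra.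
have ccl : continuous cl.
  move=> x; apply/cvgrPdist_lt => b b0; apply/nbhs_ballP; exists b => //= t xt.
  exact: le_lt_trans (cl_lip x t) xt.
(* Clamping makes the function constant left of [- N]; subtracting that constant makes it vanish
   there. It is added back to [g] at the end. *)
pose phi x := f (cl x) - f (- N).
have cphi : continuous phi.
  move=> x; apply: cvgB; last exact: cvg_cst.
  by apply: continuous_comp; [exact: ccl|exact: cf].
have vphi : vanishing_left phi.
  exists (- N) => x xN; rewrite /phi (_ : cl x = - N) ?subrr//.
  rewrite /cl max_l// ge_min xN orbT//.
have phiM x : `|phi x| <= 2 * M.
  by rewrite mulr_natl mulr2n (le_trans (ler_normB _ _))// lerD.
have [F1 [dF1 cF1 vF1]] := antiderivative cphi vphi.
have [F2 [dF2 cF2 vF2]] := antiderivative cF1 vF1.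
have [F3 [dF3 _ _]] := antiderivative cF2 vF2.
have [r r0 unif] := Heine_segment (- N) N cf e0.
(* Three averages shift the argument by at most [3 h], which is below the modulus [r]. *)
pose h := r / 4; have h0 : 0 < h by rewrite divr_gt0.
pose D := dq h.
have dD G G' : (forall x, is_derive x 1 G (G' x)) -> forall x, is_derive x 1 (D G) (D G' x).
  exact: is_derive_dq.
pose g := D (D (D F3)).
have mean G G' : (forall x, is_derive x 1 G (G' x)) ->
    forall x, exists2 t, 0 <= t <= h & D G x = G' (x + t).
  exact: dq_mean.
have d0 := dD _ _ (dD _ _ (dD _ _ dF3)).
have d1 := dD _ _ (dD _ _ (dD _ _ dF2)).
have d2 := dD _ _ (dD _ _ (dD _ _ dF1)).
have m2 x : exists2 t, 0 <= t <= 2 * h & D (D F2) x = phi (x + t).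
  have [t ht ->] := mean _ _ (dD _ _ dF2) x.
  have [u hu ->] := mean _ _ dF1 (x + t).
  by exists (t + u); [lra|rewrite addrA].
have m3 x : exists2 t, 0 <= t <= 3 * h & g x = phi (x + t).
  have [t ht gE] := mean _ _ (dD _ _ (dD _ _ dF3)) x.
  have [u hu uE] := m2 (x + t).
  by exists (t + u); [lra|rewrite /g gE uE addrA].
have Dbound G B : (forall x, `|G x| <= B) -> forall x, `|D G x| <= 2 * B / h.
  move=> GB x; rewrite /D /dq normrM normfV (gtr0_norm h0) ler_pM2r ?invr_gt0//.
  by rewrite mulr_natl mulr2n (le_trans (ler_normB _ _))// lerD.
have g3b := Dbound _ _ (Dbound _ _ (Dbound _ _ phiM)).
have g1b : forall x, `|D (D (D F2)) x| <= 2 * (2 * M) / h.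
  by apply: Dbound => x; have [t _ ->] := m2 x.
set K3 := _ / h in g3b; set K1 := _ / h in g1b.
have K30 : 0 <= K3 by exact: le_trans (g3b 0).
have K10 : 0 <= K1 by exact: le_trans (g1b 0).
(* [3 M] bounds the approximant, [K1] its first derivative and [K3] its third. *)
pose C := 3 * M + K1 + K3.
exists (fun x => g x + f (- N)), (D (D (D F2))), (D (D (D F1))), C.
have cg : continuous g.
  move=> x; apply: differentiable_continuous; apply/derivable1_diffP.
  by have [] := d0 x.
split.
- by move=> x; apply: cvgD; [exact: cg|exact: cvg_cst].
- move=> x; have [t _ ->] := m3 x.
  rewrite (le_trans (ler_normD _ _))//.
  have := phiM (x + t); have := fM (- N); rewrite /C; lra.
- move=> x y; rewrite (_ : g x + f (- N) - (g y + f (- N)) = g x - g y); last by ring.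
  apply: (@le_trans _ _ (K1 * `|x - y|)); first exact: (derive_bound d0).
  by apply: ler_wpM2r => //; rewrite /C; lra.
- move=> x y; rewrite (_ : g (x + y) + f (- N) - (g x + f (- N)) = g (x + y) - g x); last by ring.
  apply: (@le_trans _ _ (K3 * `|y| ^+ 3)); first exact: (taylor3 d0 d1 d2 g3b).
  by apply: ler_wpM2r; rewrite ?exprn_ge0// /C; lra.
- move=> x; have [t /andP[t0 th] ->] := m3 x; rewrite /phi subrK mulrDr mulr1.
  rewrite (le_trans (ler_distD (f (cl x)) _ _))// addrC lerD//.
    apply: ltW; apply: unif => //; apply: (le_lt_trans (cl_lip _ _)).
    rewrite opprD addNKr normrN ger0_norm// (le_lt_trans th)// /h; lra.
  have [xN|Nx] := leP `|x| N; first by rewrite cl_id// subrr normr0 mulr_ge0 ?sqr_ge0 ?ltW.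
  apply: (@le_trans _ _ (2 * M)).
    by rewrite mulr_natl mulr2n (le_trans (ler_normB _ _))// lerD.
  rewrite (le_trans NM)// ler_pM2l// -(real_normK (num_real x)).
  by apply: lerXn2r; rewrite ?nnegrE//; exact: ltW.
Qed.

End smoothing.

(** * Random walks *)

Section moments.
Context dT (T : measurableType dT) (R : realType) (P : probability T R).
Variable zeta : T -> R.
Hypothesis mz : measurable_fun setT zeta.
Hypothesis z4 : P.-integrable setT (EFin \o (fun w => zeta w ^+ 4)).
Local Notation M i := (\int[P]_w (zeta w ^+ i)).

(** Expands the mean of a polynomial in [zeta] into moments. [n] counts coefficients, so the degree
    is at most 4; the uses supply the coefficients as [nth 0] of a list. *)
Lemma integral_pow_sum n (c : nat -> R) : (n <= 5)%N ->
  P.-integrable setT (EFin \o (fun w => \sum_(i < n) c i * zeta w ^+ i)) /\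
  (\int[P]_w (\sum_(i < n) c i * zeta w ^+ i)%:E = (\sum_(i < n) c i * M i)%:E)%E.
Proof.
elim: n => [_|n IH n5].
  split.
    rewrite (_ : _ \o _ = cst 0%E); first exact: integrable0.
    by apply/funext => w /=; rewrite big_ord0.
  by under eq_integral do rewrite big_ord0; rewrite big_ord0 integral0.
have [iS eS] := IH (ltnW n5).
have iz := integrable_pow_le4 mz z4 n5.
have icz : P.-integrable setT (fun w => (c n)%:E * (zeta w ^+ n)%:E)%E.
  exact: integrableZl.
split.
  have := integrableD measurableT iS icz; apply: eq_integrable => // w _ /=.
  by rewrite big_ord_recr.
transitivity (\int[P]_w ((\sum_(i < n) c i * zeta w ^+ i)%:E + (c n)%:E * (zeta w ^+ n)%:E))%E.
  by apply: eq_integral => w _; rewrite big_ord_recr.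
rewrite (integralD measurableT iS icz) eS (integralZl measurableT iz).
rewrite big_ord_recr/= EFinD EFinM; congr (_ + _ * _)%E.
by rewrite /Rintegral fineK//; exact: (integrable_fin_num measurableT iz).
Qed.

Lemma moment0 : M 0%N = 1.
Proof.
rewrite /Rintegral; under eq_integral do rewrite expr0.
by rewrite integral_cst// [X in (_ * X)%E]probability_setT mule1.
Qed.

Section taylor_mean.
Variables (g g1 g2 : R -> R) (B C x delta : R).
Hypothesis mg : measurable_fun setT g.
Hypothesis gB : forall u, `|g u| <= B.
Hypothesis gC : forall u v,
  `|g (u + v) - g u - g1 u * v - g2 u * v ^+ 2 / 2| <= C * `|v| ^+ 3.
Hypothesis delta0 : 0 <= delta.

Lemma integrable_bounded_comp (X : T -> R) : measurable_fun setT X ->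
  P.-integrable setT (EFin \o (g \o X)).
Proof.
move=> mX; apply: measurable_bounded_integrable => //.
- by rewrite (le_lt_trans (probability_le1 _ _))// ltry.
- exact: measurableT_comp.
- exists B; split; first exact: num_real.
  by move=> b Bb w _ /=; rewrite (le_trans (gB _))// ltW.
Qed.

Lemma taylor_mean : M 1%N = 0 ->
  `|\int[P]_w g (x + delta * zeta w) - (g x + g2 x * delta ^+ 2 * M 2 / 2)|
  <= C * delta ^+ 3 * \int[P]_w (`|zeta w| ^+ 3).
Proof.
move=> M1.
have mX : measurable_fun setT (fun w => x + delta * zeta w).
  by apply: measurable_funD => //; exact: measurable_funM.
have ih := integrable_bounded_comp mX.
pose c := nth 0 [:: g x; g1 x * delta; g2 x * delta ^+ 2 / 2].
have [ip ep] := integral_pow_sum c (isT : (3 <= 5)%N).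
have pE : \int[P]_w (\sum_(i < 3) c i * zeta w ^+ i) = g x + g2 x * delta ^+ 2 * M 2 / 2.
  rewrite /Rintegral ep/= !big_ord_recr big_ord0/= moment0 M1 /c/=.
  by rewrite /Rintegral; field.
rewrite -pE -RintegralB//.
have i3 := integrable_norm3 mz z4.
have ihp : P.-integrable setT (EFin \o
    (fun w => g (x + delta * zeta w) - \sum_(i < 3) c i * zeta w ^+ i)).
  by have := integrableB measurableT ih ip; apply: eq_integrable.
apply: (le_trans (le_normr_Rintegral measurableT ihp)).
have i3C : P.-integrable setT (EFin \o (fun w => C * delta ^+ 3 * `|zeta w| ^+ 3)).
  exact: (integrableZl measurableT (C * delta ^+ 3) i3).
rewrite -RintegralZl//; apply: le_Rintegral => //.
  by have := integrable_norm ihp; apply: eq_integrable.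
move=> w _ /=; have h := gC x (delta * zeta w).
rewrite -[leRHS]mulrA (_ : delta ^+ 3 * `|zeta w| ^+ 3 = `|delta * zeta w| ^+ 3); last first.
  by rewrite normrM ger0_norm// exprMn.
apply: le_trans h; rewrite le_eqVlt; apply/orP; left; apply/eqP; congr (`|_|).
by rewrite !big_ord_recr big_ord0/= /c/=; field.
Qed.

End taylor_mean.
End moments.

Section close.
Context {R : realType}.
Local Open Scope ereal_scope.

(** Distance at most [e], written without subtraction so that it applies to integrals of nonnegative
    extended functions. *)
Definition close (e : R) (a b : \bar R) := a <= b + e%:E /\ b <= a + e%:E.

Lemma close_trans e e' a b c : close e a b -> close e' b c -> close (e + e') a c.
Proof.
move=> [ab ba] [bc cb]; split.
  by rewrite (le_trans ab)// EFinD [(e%:E + _)]addeC addeA leeD2r.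
by rewrite (le_trans cb)// EFinD addeA leeD2r.
Qed.

Lemma close_integral d (T : measurableType d) (P : probability T R) e
    (f g : T -> \bar R) : (0 <= e)%R ->
  measurable_fun setT f -> measurable_fun setT g ->
  (forall x, 0 <= f x) -> (forall x, 0 <= g x) ->
  (forall x, close e (f x) (g x)) ->
  close e (\int[P]_x f x) (\int[P]_x g x).
Proof.
move=> e0 mf mg f0 g0 fg.
have ke (h : T -> \bar R) : measurable_fun setT h -> (forall x, 0 <= h x) ->
    \int[P]_x (h x + e%:E) = \int[P]_x h x + e%:E.
  move=> mh h0; rewrite ge0_integralD//.
  by rewrite integral_cst// [X in _ * X]probability_setT mule1.
split; rewrite -ke//; apply: ge0_le_integral => //.
- exact: emeasurable_funD.
- by move=> x _; have [] := fg x.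
- exact: emeasurable_funD.
- by move=> x _; have [] := fg x.
Qed.

Lemma close_EFin (e a b : R) : close e a%:E b%:E <-> (`|a - b| <= e)%R.
Proof.
rewrite /close -!EFinD !lee_fin ler_norml; split.
  by move=> [ab ba]; apply/andP; split; lra.
by move=> /andP[ab ba]; split; lra.
Qed.

End close.

(** * Moments of the centred walk and the strong law *)

Section walk.
Context dT (T : measurableType dT) (R : realType) (P : probability T R)
  dT' (T' : measurableType dT') (P' : probability T' R)
  (y : nat -> T -> R) (zeta : T' -> R) (c : R).
Hypothesis my : forall k, measurable_fun setT (y k).
Hypothesis y0 : forall w, y 0 w = c.
Hypothesis step : forall k (g : R -> \bar R), measurable_fun setT g ->
  (forall x, 0 <= g x)%E ->
  (\int[P]_w g (y k.+1 w) = \int[P]_w \int[P']_w' g (y k w + zeta w')%R)%E.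
Hypothesis mz : measurable_fun setT zeta.
Hypothesis z4 : P'.-integrable setT (EFin \o (fun w => zeta w ^+ 4)).
Local Notation M i := (\int[P']_w (zeta w ^+ i)).
Hypothesis z1 : M 1%N = 0.

Let M2_ge0 : 0 <= M 2%N.
Proof. by apply: Rintegral_ge0 => w _; exact: sqr_ge0. Qed.

Let integral_cstP (r : R) : (\int[P]_w r%:E = r%:E)%E.
Proof. by rewrite integral_cst// [X in (_ * X)%E]probability_setT mule1. Qed.

Let mpow k n : measurable_fun setT (fun w => (y k w ^+ n)%:E).
Proof. by apply/measurable_EFinP; exact: measurable_funX. Qed.

Let mX n : measurable_fun [set: R] (fun x : R => (x ^+ n)%:E).
Proof. by apply/measurable_EFinP; exact: measurable_funX. Qed.

Lemma walk_moment2 k : (\int[P]_w (y k w ^+ 2)%:E = (c ^+ 2 + k%:R * M 2)%:E)%E.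
Proof.
elim: k => [|k IH].
  by under eq_integral do rewrite y0; rewrite integral_cstP mul0r addr0.
rewrite (@step k (fun x => (x ^+ 2)%:E))//; last by move=> x; rewrite lee_fin sqr_ge0.
transitivity (\int[P]_w ((y k w ^+ 2)%:E + (M 2)%:E))%E.
  apply: eq_integral => w _.
  have [_ E] := integral_pow_sum mz z4 (nth 0 [:: y k w ^+ 2; 2 * y k w; 1]) (isT : (3 <= 5)%N).
  transitivity (\int[P']_w' (\sum_(i < 3) nth 0 [:: y k w ^+ 2; 2 * y k w; 1] i * zeta w' ^+ i)%:E)%E.
    by apply: eq_integral => w' _; rewrite !big_ord_recr big_ord0/=; congr EFin; ring.
  rewrite E !big_ord_recr big_ord0/= moment0 z1 -EFinD; congr EFin; ring.
have y2 w : [set: T] w -> (0 <= (y k w ^+ 2)%:E)%E by rewrite lee_fin sqr_ge0.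
have m20 (w : T) : [set: T] w -> (0 <= (M 2)%:E)%E by rewrite lee_fin.
rewrite (ge0_integralD P measurableT y2 (mpow k 2) m20)//.
by rewrite IH integral_cstP -EFinD -natr1; congr EFin; ring.
Qed.

(** In the expansion of [(y + zeta)^4] the cubic term in [y] has mean zero, and the linear one is at
    most [2 |M 3| (1 + y^2)]. One step thus adds an affine function of the second moment, which is
    [O(k)], and the sum is [O(k^2)]. *)
Lemma walk_moment4 : exists2 K, 0 <= K &
  forall k, (\int[P]_w (y k w ^+ 4)%:E <= (K * k.+1%:R ^+ 2)%:E)%E.
Proof.
have M4 : 0 <= M 4%N by apply: Rintegral_ge0 => w _; rewrite exprn_even_ge0.
(* [A] and [B] are the coefficients of that affine function; [D] is such that the step from [k] to
   [k.+1] adds at most [D * k.+1]. *)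
pose A := 6 * M 2 + 2 * `|M 3|; pose B := M 4 + 2 * `|M 3|.
have A0 : 0 <= A by rewrite addr_ge0 ?mulr_ge0.
have B0 : 0 <= B by rewrite addr_ge0 ?mulr_ge0.
pose D := A * (c ^+ 2 + M 2) + B.
have D0 : 0 <= D by rewrite /D addr_ge0// mulr_ge0// addr_ge0// sqr_ge0.
have c4 : 0 <= c ^+ 4 by rewrite exprn_even_ge0.
exists (c ^+ 4 + D); first by rewrite addr_ge0.
have y4 k w : (0 <= (y k w ^+ 4)%:E)%E by rewrite lee_fin exprn_even_ge0.
have y2 k w : (0 <= (y k w ^+ 2)%:E)%E by rewrite lee_fin exprn_even_ge0.
elim=> [|k IH].
  under eq_integral do rewrite y0.
  by rewrite integral_cstP expr1n mulr1 lee_fin lerDl.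
rewrite (@step k (fun x => (x ^+ 4)%:E))//; last by move=> x; rewrite lee_fin exprn_even_ge0.
apply: (@le_trans _ _ (\int[P]_w ((y k w ^+ 4)%:E + (A%:E * (y k w ^+ 2)%:E + B%:E)))%E).
  pose q (x : R) := nth 0 [:: x ^+ 4; 4 * x ^+ 3; 6 * x ^+ 2; 4 * x; 1].
  have E w : (\int[P']_w' ((y k w + zeta w') ^+ 4)%:E =
      (y k w ^+ 4 + 6 * y k w ^+ 2 * M 2 + 4 * y k w * M 3 + M 4)%:E)%E.
    have [_ E] := integral_pow_sum mz z4 (q (y k w)) (isT : (5 <= 5)%N).
    transitivity (\int[P']_w' (\sum_(i < 5) q (y k w) i * zeta w' ^+ i)%:E)%E.
      by apply: eq_integral => w' _; rewrite !big_ord_recr big_ord0/= /q/=; congr EFin; ring.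
    by rewrite E !big_ord_recr big_ord0/= moment0 z1 /q/=; congr EFin; ring.
  under eq_integral do rewrite E.
  have mE : measurable_fun setT (fun w => (y k w ^+ 4 + 6 * y k w ^+ 2 * M 2 + 4 * y k w * M 3 + M 4)%:E).
    apply/measurable_EFinP; apply: measurable_funD => //; apply: measurable_funD.
      apply: measurable_funD; first exact: measurable_funX.
      by apply: measurable_funM => //; apply: measurable_funM => //; exact: measurable_funX.
    by apply: measurable_funM => //; exact: measurable_funM.
  apply: ge0_le_integral => //.
  - by move=> w _; rewrite -E; apply: integral_ge0 => w' _; rewrite lee_fin exprn_even_ge0.
  - by do 2 (apply: emeasurable_funD => //); apply: emeasurable_funM.
  move=> w _; rewrite -EFinM -!EFinD lee_fin -!addrA lerD2l /A /B.
  set z := y k w; set m := M 3.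
  have h : 4 * z * m <= 2 * `|m| * (1 + z ^+ 2).
    rewrite (le_trans (ler_norm _))// !normrM ger0_norm//.
    have := normr_ge0 m; have -> : z ^+ 2 = `|z| ^+ 2 by rewrite real_normK// num_real.
    by move=> m0; have := sqr_ge0 (`|z| - 1); nra.
  lra.
have mA : measurable_fun setT (fun w => A%:E * (y k w ^+ 2)%:E)%E.
  exact: emeasurable_funM.
have hA w : [set: T] w -> (0 <= A%:E * (y k w ^+ 2)%:E)%E by rewrite mule_ge0.
have hB (w : T) : [set: T] w -> (0 <= B%:E)%E by rewrite lee_fin.
have mAB : measurable_fun setT (fun w => A%:E * (y k w ^+ 2)%:E + B%:E)%E.
  exact: emeasurable_funD.
have hAB w : [set: T] w -> (0 <= A%:E * (y k w ^+ 2)%:E + B%:E)%E.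
  by move=> _; rewrite adde_ge0 ?hA ?hB.
rewrite (ge0_integralD P measurableT (fun w _ => y4 k w) (mpow k 4) hAB)//.
rewrite (ge0_integralD P measurableT hA mA hB)//.
rewrite ge0_integralZl// walk_moment2 integral_cstP.
apply: (le_trans (leeD2r _ IH)); rewrite -EFinM -!EFinD lee_fin.
rewrite -[in leRHS]natr1; set n : R := k.+1%:R.
have n1 : 1 <= n by rewrite ler1n.
have kn : k%:R <= n :> R by rewrite ler_nat.
have k0 : 0 <= k%:R :> R by [].
have : A * (c ^+ 2 + k%:R * M 2) + B <= D * n.
  have -> : D * n = A * (c ^+ 2 * n + n * M 2) + B * n by rewrite /D; ring.
  apply: lerD; last by rewrite ler_peMr.
  apply: ler_wpM2l => //; apply: lerD; first by rewrite ler_peMr ?sqr_ge0.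
  exact: ler_wpM2r.
have -> : (c ^+ 4 + D) * (n + 1) ^+ 2 = (c ^+ 4 + D) * n ^+ 2 + (c ^+ 4 + D) * (2 * n + 1) by ring.
move=> h; rewrite lerD2l (le_trans h)//.
apply: (@le_trans _ _ (D * (2 * n + 1))).
  by apply: ler_wpM2l => //; lra.
by apply: ler_wpM2r; [lra|rewrite lerDr].
Qed.

Lemma walk_slln : {ae P, forall w, (fun k : nat => k%:R^-1 * y k w) @ \oo --> (0 : R)}.
Proof.
have [K K0 yK] := walk_moment4.
pose u k w : R := k.+1%:R^-1 * y k.+1 w.
have mu4 k : measurable_fun setT (fun w => (u k w ^+ 4)%:E).
  by apply/measurable_EFinP; apply: measurable_funX; exact: measurable_funM.
have u4 k w : (0 <= (u k w ^+ 4)%:E)%E by rewrite lee_fin exprn_even_ge0.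
pose S w := (\sum_(k <oo) (u k w ^+ 4)%:E)%E.
have iu k : (\int[P]_w (u k w ^+ 4)%:E <= (4 * K)%:E * (k.+1%:R ^- 2)%:E)%E.
  pose n : R := k.+1%:R.
  have n0 : 0 < n by rewrite ltr0n.
  have n1 : 1 <= n by rewrite ler1n.
  have -> : (\int[P]_w (u k w ^+ 4)%:E = (n ^- 4)%:E * \int[P]_w (y k.+1 w ^+ 4)%:E)%E.
    have y4 w : [set: T] w -> (0 <= (y k.+1 w ^+ 4)%:E)%E by rewrite lee_fin exprn_even_ge0.
    have n4 : (0 <= (n ^- 4)%:E)%E by rewrite lee_fin invr_ge0 exprn_ge0.
    rewrite -(ge0_integralZl P measurableT (mpow k.+1 4) y4 n4).
    by apply: eq_integral => w _; rewrite -EFinM /u exprMn exprVn.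
  apply: (@le_trans _ _ ((n ^- 4)%:E * (K * k.+2%:R ^+ 2)%:E)%E).
    by apply: lee_wpmul2l; rewrite ?yK// lee_fin invr_ge0 exprn_ge0.
  rewrite -!EFinM lee_fin -natr1 -/n.
  (* The moment bound at time [n = k.+1] carries [(n + 1) ^+ 2 <= 4 * n ^+ 2], whence the factor
     4. *)
  have -> : 4 * K * n ^- 2 = n ^- 4 * (K * (4 * n ^+ 2)) by field; rewrite gt_eqF.
  apply: ler_wpM2l; first by rewrite invr_ge0 exprn_ge0// ltW.
  by apply: ler_wpM2l => //; nra.
have S0 w : (0 <= S w)%E by apply: nneseries_ge0.
have iS : P.-integrable setT S.
  apply/integrableP; split; first by apply: ge0_emeasurable_sum => // k w _ _.
  have -> : (\int[P]_w `|S w| = \int[P]_w S w)%E.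
    by apply: eq_integral => w _; rewrite gee0_abs.
  rewrite integral_nneseries//.
  apply: (@le_lt_trans _ _ (\sum_(k <oo) (4 * K)%:E * (k.+1%:R ^- 2)%:E)%E).
    by apply: lee_nneseries => [k _ _|k _]; [exact: integral_ge0|exact: iu].
  rewrite nneseriesZl//.
  by rewrite lte_mul_pinfty ?nneseries_inv_sqr_lty// lee_fin mulr_ge0.
have := integrable_ae measurableT iS; apply: filterS => w /(_ I) Sfin.
have Slty : (S w < +oo)%E by rewrite ltey_eq Sfin.
have tail := nneseries_tail_cvg Slty (fun k _ => u4 k w).
rewrite -cvg_shiftS; apply/cvgr0Pnorm_lt => e e0.
have H : nbhs (0%E : \bar R) [set x | (x < (e ^+ 4)%:E)%E].
  apply: open_nbhs_nbhs; split; first exact: open_ereal_lt_ereal.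
  by rewrite /= lte_fin exprn_gt0.
have H2 : \forall n \near \oo, (\sum_(n <= k <oo) (u k w ^+ 4)%:E < (e ^+ 4)%:E)%E.
  exact: (tail _ H).
near=> n; rewrite ltNge; apply/negP => eu.
have : (\sum_(n <= k <oo) (u k w ^+ 4)%:E < (e ^+ 4)%:E)%E by near: n.
apply/negP; rewrite -leNgt.
(* The first term of a tail is at most the whole tail, so [e <= |u n w|] would make the tail at
   least [e ^+ 4]. *)
apply: (@le_trans _ _ (\sum_(n <= k < n.+1) (u k w ^+ 4)%:E)%E); last first.
  exact: nneseries_lim_ge.
rewrite big_nat1 lee_fin -[leRHS]ger0_norm ?exprn_even_ge0// normrX.
by apply: lerXn2r; rewrite ?nnegrE//; exact: ltW.
Unshelve. all: by end_near. Qed.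

End walk.

(** * Lindeberg replacement and the central limit theorem for the walk *)

Section clt.
Context dT (T : measurableType dT) (R : realType) (P : probability T R)
  dT' (T' : measurableType dT') (P' : probability T' R)
  (y : nat -> T -> R) (zeta : T' -> R) (c : R) (gamma : probability R R) (s : R).
Hypothesis my : forall k, measurable_fun setT (y k).
Hypothesis y0 : forall w, y 0 w = c.
Hypothesis step : forall k (g : R -> \bar R), measurable_fun setT g ->
  (forall x, 0 <= g x)%E ->
  (\int[P]_w g (y k.+1 w) = \int[P]_w \int[P']_w' g (y k w + zeta w')%R)%E.
Hypothesis mz : measurable_fun setT zeta.
Hypothesis z4 : P'.-integrable setT (EFin \o (fun w => zeta w ^+ 4)).
Hypothesis z1 : \int[P']_w (zeta w ^+ 1) = 0.
Hypothesis z2 : \int[P']_w (zeta w ^+ 2) = s ^+ 2.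
Hypothesis s0 : 0 <= s.
Hypothesis gammaD : forall (c s : R) (f : R -> \bar R),
  measurable_fun setT f -> (forall x, 0 <= f x)%E ->
  (\int[gamma]_x \int[gamma]_y f (c * x + s * y)%R =
   \int[gamma]_x f (Num.sqrt (c ^+ 2 + s ^+ 2) * x)%R)%E.
Hypothesis gamma4 : gamma.-integrable setT (EFin \o (fun z : R => z ^+ 4)).
Hypothesis gamma1 : \int[gamma]_z (z ^+ 1) = 0.
Hypothesis gamma2 : \int[gamma]_z (z ^+ 2) = 1.

Let mid : measurable_fun [set: R] (fun z : R => z).
Proof. by []. Qed.

Let msz : measurable_fun [set: R] (fun z : R => s * z).
Proof. exact: measurable_funM. Qed.

Let sz4 : gamma.-integrable setT (EFin \o (fun z : R => (s * z) ^+ 4)).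
Proof.
have := integrableZl measurableT (s ^+ 4) gamma4.
by apply: eq_integrable => // z _ /=; rewrite exprMn.
Qed.

Let sz_pow n : (n <= 4)%N ->
  \int[gamma]_z ((s * z) ^+ n) = s ^+ n * \int[gamma]_z (z ^+ n).
Proof.
move=> n4; rewrite -RintegralZl//; last exact: (integrable_pow_le4 mid gamma4 n4).
by apply: eq_Rintegral => z _; rewrite exprMn.
Qed.

Let EFin_Rintegral d (U : measurableType d) (Q : probability U R) (h : U -> R) :
  Q.-integrable setT (EFin \o h) ->
  (\int[Q]_w (h w)%:E)%E = (\int[Q]_w h w)%:E.
Proof.
by move=> ih; rewrite /Rintegral fineK//; exact: (integrable_fin_num measurableT ih).
Qed.

Section smooth.
Variables (g g1 g2 : R -> R) (C : R).
Hypothesis mg : measurable_fun setT g.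
Hypothesis g0 : forall u, 0 <= g u.
Hypothesis gB : forall u, `|g u| <= C.
Hypothesis gL : forall u v, `|g u - g v| <= C * `|u - v|.
Hypothesis gT : forall u v,
  `|g (u + v) - g u - g1 u * v - g2 u * v ^+ 2 / 2| <= C * `|v| ^+ 3.

Let C0 : 0 <= C. Proof. exact: le_trans (gB 0). Qed.

Let kappa := \int[P']_w (`|zeta w| ^+ 3) + \int[gamma]_z (`|s * z| ^+ 3).

Let kappa0 : 0 <= kappa.
Proof. by rewrite addr_ge0//; apply: Rintegral_ge0 => w _; exact: exprn_ge0. Qed.

Let maff (a b : R) : measurable_fun [set: R] (fun z : R => a + b * z).
Proof. by apply: measurable_funD => //; exact: measurable_funM. Qed.

Lemma kernel_close x delta : 0 <= delta ->
  close (C * delta ^+ 3 * kappa) (\int[P']_w (g (x + delta * zeta w))%:E)%E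
    (\int[gamma]_z (g (x + delta * (s * z)))%:E)%E.
Proof.
move=> d0.
have mX : measurable_fun setT (fun w => x + delta * zeta w).
  by apply: measurable_funD => //; exact: measurable_funM.
have mY : measurable_fun [set: R] (fun z : R => x + delta * (s * z)).
  by apply: measurable_funD => //; exact: measurable_funM.
rewrite (EFin_Rintegral (integrable_bounded_comp P' mg gB mX)).
rewrite (EFin_Rintegral (integrable_bounded_comp gamma mg gB mY)).
apply/close_EFin.
have h1 := taylor_mean mz z4 x mg gB gT d0 z1.
have h2 := taylor_mean msz sz4 x mg gB gT d0.
rewrite (sz_pow (isT : (1 <= 4)%N)) gamma1 mulr0 in h2.
rewrite (sz_pow (isT : (2 <= 4)%N)) gamma2 mulr1 in h2.
rewrite z2 in h1.
rewrite (le_trans (ler_distD (g x + g2 x * delta ^+ 2 * s ^+ 2 / 2) _ _))//.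
by rewrite mulrDr lerD// distrC h2.
Qed.

(** Mean of [g] after [m] Gaussian steps of deviation [delta * s] from [x], merged into a single
    Gaussian. *)
Let u delta m x := (\int[gamma]_z (g (x + delta * s * Num.sqrt m%:R * z))%:E)%E.

Let u0 delta m x : (0 <= u delta m x)%E.
Proof. by apply: integral_ge0 => z _; rewrite lee_fin. Qed.

Let mgE : measurable_fun [set: R] (EFin \o g).
Proof. exact/measurable_EFinP. Qed.

Let mu delta m : measurable_fun [set: R] (u delta m).
Proof.
apply: (measurable_fun_fubini_tonelli_F (m2 := gamma)
  (fun p : R * R => (g (p.1 + delta * s * Num.sqrt m%:R * p.2))%:E)).
  apply: (measurableT_comp mgE); apply: measurable_funD => //.
  exact: measurable_funM.
by move=> p; rewrite lee_fin.
Qed.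

(** Tonelli moves the [m] Gaussian steps outside, so the single walk step is compared with a
    Gaussian one by [kernel_close] at each point [x + k * z]; [gammaD] then merges [m + 1] Gaussian
    steps. *)
Lemma smooth_step x delta m : 0 <= delta ->
  close (C * delta ^+ 3 * kappa) (\int[P']_w u delta m (x + delta * zeta w))%E
    (u delta m.+1 x).
Proof.
move=> d0; set k := delta * s * Num.sqrt m%:R.
have mG : measurable_fun setT (fun p : T' * R => (g (x + delta * zeta p.1 + k * p.2))%:E).
  apply: (measurableT_comp mgE); apply: measurable_funD; last exact: measurable_funM.
  apply: measurable_funD => //; apply: measurable_funM => //.
  exact: (measurableT_comp mz measurable_fst).
have mH : measurable_fun setT (fun p : R * R => (g (x + k * p.1 + delta * (s * p.2)))%:E).
  apply: (measurableT_comp mgE); apply: measurable_funD.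
    by apply: measurable_funD => //; exact: measurable_funM.
  by apply: measurable_funM => //; exact: measurable_funM.
have mG' : measurable_fun setT (fun p : R * T' => (g (x + k * p.1 + delta * zeta p.2))%:E).
  apply: (measurableT_comp mgE); apply: measurable_funD.
    by apply: measurable_funD => //; exact: measurable_funM.
  by apply: measurable_funM => //; exact: (measurableT_comp mz measurable_snd).
have -> : (\int[P']_w u delta m (x + delta * zeta w) =
    \int[gamma]_z \int[P']_w (g (x + k * z + delta * zeta w))%:E)%E.
  rewrite /u (fubini_tonelli (m1 := P') (m2 := gamma) _ mG); last first.
    by move=> p; rewrite lee_fin.
  by apply: eq_integral => z _; apply: eq_integral => w _; rewrite addrAC.
have -> : (u delta m.+1 x = \int[gamma]_z \int[gamma]_v (g (x + k * z + delta * (s * v)))%:E)%E.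
  have mgx : measurable_fun [set: R] (fun t => (g (x + t))%:E).
    by apply: (measurableT_comp mgE); exact: measurable_funD.
  have := @gammaD k (delta * s) _ mgx (fun t => g0 (x + t)).
  have -> : Num.sqrt (k ^+ 2 + (delta * s) ^+ 2) = delta * s * Num.sqrt m.+1%:R.
    rewrite /k exprMn sqr_sqrtr// -[X in _ + X]mulr1 -mulrDr natr1.
    by rewrite sqrtrM ?sqr_ge0// sqrtr_sqr ger0_norm// mulr_ge0.
  rewrite /u => <-; apply: eq_integral => z _; apply: eq_integral => v _.
  by rewrite addrA mulrA.
apply: close_integral.
- by rewrite mulr_ge0// mulr_ge0// exprn_ge0.
- exact: (measurable_fun_fubini_tonelli_F (m2 := P') _ mG' (fun p => g0 _)).
- exact: (measurable_fun_fubini_tonelli_F (m2 := gamma) _ mH (fun p => g0 _)).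
- by move=> z; apply: integral_ge0 => w _; rewrite lee_fin.
- by move=> z; apply: integral_ge0 => w _; rewrite lee_fin.
- by move=> z; exact: kernel_close.
Qed.

(** Each induction step trades the last walk step for a Gaussian one, passing from [(m, k.+1)] to
    [(m.+1, k)]; hence the generality in [m]. *)
Lemma walk_close delta m k : 0 <= delta ->
  close (k%:R * (C * delta ^+ 3 * kappa))
    (\int[P]_w u delta m (delta * y k w))%E (u delta (m + k) (delta * c)).
Proof.
move=> d0; set e := C * _ * _.
have e0 : 0 <= e by rewrite /e !mulr_ge0// exprn_ge0.
elim: k m => [|k IH] m.
  have -> : (\int[P]_w u delta m (delta * y 0 w) = u delta (m + 0) (delta * c))%E.
    under eq_integral do rewrite y0.
    by rewrite addn0 integral_cst// [X in (_ * X)%E]probability_setT mule1.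
  by rewrite mul0r /close adde0.
rewrite -natr1 mulrDl mul1r addrC -addSnnS.
apply: close_trans (IH m.+1).
have mud : measurable_fun [set: R] (fun x => u delta m (delta * x)).
  by apply: (measurableT_comp (mu delta m)); exact: measurable_funM.
rewrite (step k mud (fun x => u0 _ _ _)).
have mI : measurable_fun setT (fun p : R * T' => u delta m (delta * (p.1 + zeta p.2))).
  apply: (measurableT_comp mud); apply: measurable_funD => //.
  exact: (measurableT_comp mz measurable_snd).
have mF := measurable_fun_fubini_tonelli_F (m2 := P') _ mI (fun p => u0 _ _ _).
apply: close_integral.
- exact: e0.
- exact: (measurableT_comp mF (my k)).
- by apply: (measurableT_comp (mu delta m.+1)); exact: measurable_funM.
- by move=> w; apply: integral_ge0 => w' _; exact: u0.
- by move=> w; exact: u0.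
- move=> w; under eq_integral do rewrite mulrDr.
  exact: smooth_step.
Qed.

(** With [delta = n^(-1/2)], the [n] replacements cost [C * kappa / sqrt n] altogether. The term in
    [|c|] comes from moving the start [delta * c] to 0 by the Lipschitz bound. *)
Lemma clt_smooth_ge0 n : (0 < n)%N ->
  `|\int[P]_w g (y n w / Num.sqrt n%:R) - \int[gamma]_z g (s * z)|
  <= (C * kappa + C * `|c|) / Num.sqrt n%:R.
Proof.
move=> n0; set delta := (Num.sqrt n%:R)^-1.
have r0 : 0 < Num.sqrt n%:R :> R by rewrite sqrtr_gt0 ltr0n.
have d0 : 0 <= delta by rewrite invr_ge0 ltW.
have my' : measurable_fun setT (fun w => y n w * delta).
  exact: measurable_funM.
have i1 := integrable_bounded_comp P mg gB my'.
have i2 := integrable_bounded_comp gamma mg gB msz.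
apply/close_EFin; rewrite -(EFin_Rintegral i1) -(EFin_Rintegral i2).
have H := walk_close 0 n d0.
have E1 : (\int[P]_w u delta 0 (delta * y n w) = \int[P]_w (g (y n w * delta))%:E)%E.
  apply: eq_integral => w _; rewrite /u sqrtr0.
  under eq_integral do rewrite mulr0 mul0r addr0.
  by rewrite integral_cst// [X in (_ * X)%E]probability_setT mule1 mulrC.
have E2 : (u delta n (delta * c) = \int[gamma]_z (g (delta * c + s * z))%:E)%E.
  apply: eq_integral => z _; congr ((g (_ + _ * _))%:E).
  by rewrite mulrAC /delta mulVf ?mul1r// gt_eqF.
rewrite {}E1 add0n {}E2 in H.
have -> : (C * kappa + C * `|c|) * delta = n%:R * (C * delta ^+ 3 * kappa) + C * (delta * `|c|).
  have <- : (Num.sqrt n%:R) ^+ 2 = n%:R :> R by rewrite sqr_sqrtr.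
  by rewrite /delta; field; rewrite gt_eqF.
apply: (close_trans H).
apply: close_integral.
- by apply: mulr_ge0; [exact: C0|apply: mulr_ge0; [exact: d0|exact: normr_ge0]].
- exact: (measurableT_comp mgE (maff (delta * c) s)).
- exact: (measurableT_comp mgE msz).
- by move=> z; exact: g0.
- by move=> z; exact: g0.
- move=> z; apply/close_EFin; apply: (le_trans (gL _ _)).
  by rewrite addrK normrM ger0_norm.
Qed.

End smooth.

Let Rintegral_addC d (U : measurableType d) (Q : probability U R) (h : U -> R) (b : R) :
  Q.-integrable setT (EFin \o h) -> \int[Q]_w (h w + b) = \int[Q]_w h w + b.
Proof.
move=> ih; rewrite (RintegralD measurableT ih); last first.
  exact: finite_measure_integrable_cst.
congr (_ + _); rewrite /Rintegral integral_cst// [X in (_ * X)%E]probability_setT.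
by rewrite mule1.
Qed.

(** The replacement works with nonnegative functions, so it is applied to [g + C], at the price of
    the constant [2 * C]; the shift cancels in the difference. *)
Lemma clt_smooth (g g1 g2 : R -> R) (C : R) :
  measurable_fun setT g -> (forall u, `|g u| <= C) ->
  (forall u v, `|g u - g v| <= C * `|u - v|) ->
  (forall u v, `|g (u + v) - g u - g1 u * v - g2 u * v ^+ 2 / 2| <= C * `|v| ^+ 3) ->
  (fun n => \int[P]_w g (y n w / Num.sqrt n%:R)) @ \oo --> \int[gamma]_z g (s * z).
Proof.
move=> mg gB gL gT.
have C0 : 0 <= C by exact: le_trans (gB 0).
have C2 : C <= 2 * C by lra.
have mgC : measurable_fun [set: R] (fun u => g u + C) by exact: measurable_funD.
have gC0 u : 0 <= g u + C by have := gB u; rewrite ler_norml; lra.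
have gCB u : `|g u + C| <= 2 * C.
  by rewrite (le_trans (ler_normD _ _))// (ger0_norm C0) mulr_natl mulr2n lerD.
have gCL u v : `|g u + C - (g v + C)| <= 2 * C * `|u - v|.
  rewrite (_ : g u + C - (g v + C) = g u - g v); last by ring.
  by rewrite (le_trans (gL _ _))// ler_wpM2r.
have gCT u v : `|g (u + v) + C - (g u + C) - g1 u * v - g2 u * v ^+ 2 / 2|
    <= 2 * C * `|v| ^+ 3.
  rewrite (_ : g (u + v) + C - (g u + C) = g (u + v) - g u); last by ring.
  by rewrite (le_trans (gT _ _))// ler_wpM2r// exprn_ge0.
have H := clt_smooth_ge0 mgC gC0 gCB gCL gCT.
set K := (2 * C * _ + 2 * C * `|c|) in H.
apply/cvgrPdist_lt => e e0.
near=> n.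
have n0 : (0 < n)%N by near: n; exact: nbhs_infty_gt.
have nK : (K / e) ^+ 2 < n%:R by near: n; exact: nbhs_infty_gtr.
have r0 : 0 < Num.sqrt n%:R :> R by rewrite sqrtr_gt0 ltr0n.
have my' : measurable_fun setT (fun w => y n w / Num.sqrt n%:R).
  exact: measurable_funM.
have := H n n0.
rewrite (Rintegral_addC C (integrable_bounded_comp P mg gB my')).
rewrite (Rintegral_addC C (integrable_bounded_comp gamma mg gB msz)) => h.
rewrite distrC; apply: (le_lt_trans _ (_ : K / Num.sqrt n%:R < e)).
  by move: h; rewrite opprD addrACA subrr addr0.
rewrite ltr_pdivrMr// mulrC -ltr_pdivrMr//.
rewrite (le_lt_trans (ler_norm _))// -sqrtr_sqr ltr_sqrt// ltr0n.
by [].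
Unshelve. all: by end_near. Qed.

(** Transfers the approximation to means, uniformly over all laws with second moment at most [V]. *)
Lemma Rintegral_close_quadratic d (U : measurableType d) (Q : probability U R)
    (X : U -> R) (f g : R -> R) (Mf Mg e V : R) :
  measurable_fun setT X -> measurable_fun setT f -> measurable_fun setT g ->
  (forall x, `|f x| <= Mf) -> (forall x, `|g x| <= Mg) ->
  (forall x, `|f x - g x| <= e * (1 + x ^+ 2)) -> 0 <= e ->
  Q.-integrable setT (EFin \o (fun w => X w ^+ 2)) ->
  \int[Q]_w (X w ^+ 2) <= V ->
  `|\int[Q]_w f (X w) - \int[Q]_w g (X w)| <= e * (1 + V).
Proof.
move=> mX mf mg fM gM fg e0 iX2 XV.
have i1 := integrable_bounded_comp Q mf fM mX.
have i2 := integrable_bounded_comp Q mg gM mX.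
have i12 : Q.-integrable setT (EFin \o (fun w => f (X w) - g (X w))).
  by have := integrableB measurableT i1 i2; apply: eq_integrable.
have iq : Q.-integrable setT (EFin \o (fun w => X w ^+ 2 + 1)).
  have i1' : Q.-integrable setT (EFin \o cst (1 : R)) by exact: finite_measure_integrable_cst.
  by have := integrableD measurableT iX2 i1'; apply: eq_integrable.
have ieq : Q.-integrable setT (EFin \o (fun w => e * (X w ^+ 2 + 1))).
  exact: (integrableZl measurableT e iq).
rewrite -(RintegralB measurableT i1 i2).
apply: (le_trans (le_normr_Rintegral measurableT i12)).
apply: (@le_trans _ _ (\int[Q]_w (e * (X w ^+ 2 + 1)))).
  apply: le_Rintegral => //; first by have := integrable_norm i12; apply: eq_integrable.
  by move=> w _ /=; rewrite [_ ^+ 2 + 1]addrC; exact: fg.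
rewrite (RintegralZl e measurableT iq) ler_wpM2l// (Rintegral_addC 1 iX2) addrC lerD2l.
exact: XV.
Qed.

Lemma walk_clt (f : R -> R) (B : R) : continuous f -> (forall x, `|f x| <= B) ->
  (fun n => \int[P]_w f (y n w / Num.sqrt n%:R)) @ \oo --> \int[gamma]_z f (s * z).
Proof.
move=> cf fB; apply/cvgrPdist_lt => e e0.
(* Bounds the second moment [c^2 / n + s^2] of the rescaled walk for every [n > 0], and that of the
   limit; [b] makes each approximation error [e / 4]. *)
pose V := c ^+ 2 + s ^+ 2.
have V0 : 0 <= V by rewrite addr_ge0 ?sqr_ge0.
have V1 : 0 < 1 + V by rewrite ltr_pwDl.
pose b := e / 4 / (1 + V).
have b0 : 0 < b by rewrite !divr_gt0.
have bV : b * (1 + V) = e / 4 by rewrite /b divfK ?gt_eqF.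
have [g [g1 [g2 [C [cg gB gL gT fg]]]]] := smooth_approx cf fB b0.
have mf := continuous_measurable_fun cf.
have mg := continuous_measurable_fun cg.
have /cvgrPdist_lt/(_ (e / 4)) := clt_smooth mg gB gL gT.
rewrite divr_gt0// => /(_ isT) Hg.
have E2 : `|\int[gamma]_z f (s * z) - \int[gamma]_z g (s * z)| <= b * (1 + V).
  apply: (Rintegral_close_quadratic msz mf mg fB gB fg (ltW b0)).
    exact: (integrable_pow_le4 msz sz4 (isT : (2 <= 4)%N)).
  by rewrite (sz_pow (isT : (2 <= 4)%N)) gamma2 mulr1 /V lerDr sqr_ge0.
near=> n.
have n0 : (0 < n)%N by near: n; exact: nbhs_infty_gt.
have nR : 0 < n%:R :> R by rewrite ltr0n.
have my' : measurable_fun setT (fun w => y n w / Num.sqrt n%:R) by exact: measurable_funM.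
have mom := walk_moment2 my y0 step mz z4 z1 n.
rewrite z2 in mom.
have mom2 : \int[P]_w (y n w ^+ 2) = c ^+ 2 + n%:R * s ^+ 2 by rewrite /Rintegral mom.
have iy2 : P.-integrable setT (EFin \o (fun w => y n w ^+ 2)).
  apply/integrableP; split.
    by apply/measurable_EFinP; exact: measurable_funX.
  have -> : (\int[P]_w `|(EFin \o (fun w => y n w ^+ 2)%R) w| = \int[P]_w (y n w ^+ 2)%:E)%E.
    by apply: eq_integral => w _; rewrite gee0_abs//= lee_fin sqr_ge0.
  by rewrite mom ltry.
have dE w : (y n w / Num.sqrt n%:R) ^+ 2 = n%:R^-1 * y n w ^+ 2.
  by rewrite exprMn exprVn sqr_sqrtr// mulrC.
have E1 : `|\int[P]_w f (y n w / Num.sqrt n%:R) - \int[P]_w g (y n w / Num.sqrt n%:R)| <= b * (1 + V).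
  apply: (Rintegral_close_quadratic my' mf mg fB gB fg (ltW b0)).
    have := integrableZl measurableT n%:R^-1 iy2.
    by apply: eq_integrable => // w _ /=; rewrite dE.
  have -> : \int[P]_w ((y n w / Num.sqrt n%:R) ^+ 2) = \int[P]_w (n%:R^-1 * y n w ^+ 2).
    by apply: eq_Rintegral => w _; exact: dE.
  rewrite (RintegralZl _ measurableT iy2) mom2.
  rewrite (_ : n%:R^-1 * _ = n%:R^-1 * c ^+ 2 + s ^+ 2); last by field; rewrite gt_eqF.
  by rewrite lerD2r ler_piMl ?sqr_ge0// invf_le1// ler1n.
have E3 : `|\int[gamma]_z g (s * z) - \int[P]_w g (y n w / Num.sqrt n%:R)| < e / 4 by near: n.
rewrite bV in E1 E2; rewrite distrC in E1.
rewrite (le_lt_trans (ler_distD (\int[gamma]_z g (s * z)) _ _))//.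
have := ler_distD (\int[P]_w g (y n w / Num.sqrt n%:R)) (\int[gamma]_z g (s * z))
  (\int[P]_w f (y n w / Num.sqrt n%:R)).
lra.
Unshelve. all: by end_near. Qed.
End clt.

(** * The theorem *)

(** The case [q = 0] relies on the convention [ln 0 = 0]; it lets [yE] hold at every point. *)
Lemma ln_sqrtr (R : realType) (q : R) : 0 <= q -> ln (Num.sqrt q) = 2^-1 * ln q.
Proof.
rewrite le_eqVlt => /predU1P[<-|q0]; first by rewrite sqrtr0 ln0 ?mulr0.
have r0 : 0 < Num.sqrt q by rewrite sqrtr_gt0.
by have := lnXn 2 r0; rewrite (sqr_sqrtr (ltW q0)) => ->; rewrite mulr2n; field.
Qed.

(** Brings the Dirac mass and the nondegenerate laws to the common form [sqrt v * z]. Adding [B]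
    makes [f] nonnegative, so that the scaling identity applies. *)
Lemma integral_centered_normal (R : realType) (v : R) (f : R -> R) (B : R) :
  0 <= v -> continuous f -> (forall x, `|f x| <= B) ->
  fine (\int[centered_normal v]_x (f x)%:E)%E =
  \int[normalR 0 1]_z f (Num.sqrt v * z).
Proof.
move=> v0 cf fB; have mf := continuous_measurable_fun cf.
have cstE (nu : probability R R) (b : R) : \int[nu]_x b = b.
  by rewrite /Rintegral integral_cst// [X in (_ * X)%E]probability_setT mule1.
rewrite /centered_normal; have [->|vN0] := eqVneq v 0.
  rewrite sqrtr0; under eq_Rintegral do rewrite mul0r.
  rewrite cstE integral_dirac//; last exact/measurable_EFinP.
  by rewrite diracT mul1e.
have s0 : 0 < Num.sqrt v by rewrite sqrtr_gt0 lt_neqAle eq_sym vN0.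
have B0 : 0 <= B by exact: le_trans (fB 0).
have fB0 x : 0 <= f x + B by have := fB x; rewrite ler_norml; lra.
have mid : measurable_fun [set: R] (fun x : R => x) by [].
have msz : measurable_fun [set: R] (fun x : R => Num.sqrt v * x) by exact: measurable_funM.
have i1 := integrable_bounded_comp (normalR 0 (Num.sqrt v)) mf fB mid.
have i2 := integrable_bounded_comp (normalR 0 1) mf fB msz.
have add (nu : probability R R) (h : R -> R) : nu.-integrable setT (EFin \o h) ->
    \int[nu]_x (h x + B) = \int[nu]_x h x + B.
  move=> ih; rewrite (RintegralD measurableT ih) ?cstE//.
  exact: finite_measure_integrable_cst.
apply: (addIr B).
have mfB : measurable_fun [set: R] (fun x => (f x + B)%:E).
  by apply/measurable_EFinP; exact: measurable_funD.
have := ge0_integral_normalRZ s0 mfB (fun x => fB0 x).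
move=> /(congr1 fine) H.
exact: (etrans (esym (add _ _ i1)) (etrans H (add _ _ i2))).
Qed.

(** * The network as a random walk *)

Section network.
Context (R : realType) (d : nat) (dT : measure_display)
  (T : measurableType dT) (P : probability T R)
  (sigma a : R) (x0 : 'cV[R]_d) (W : nat -> T -> 'M[R]_d).
Hypothesis d0 : (0 < d)%N.
Hypothesis sigma0 : 0 < sigma.
Hypothesis a01 : 0 < a <= 1.
Hypothesis x00 : x0 != 0.
Hypothesis iW : mutually_independent P
    (fun p : nat * ('I_d * 'I_d) => fun w => W p.1 w p.2.1 p.2.2).
Hypothesis lW : forall k i j, has_normal_law P sigma (fun w => W k w i j).
Context (dT' : measure_display) (T' : measurableType dT')
  (P' : probability T' R) (Z : 'I_d -> T' -> R).
Hypothesis iZ : mutually_independent P' Z.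
Hypothesis lZ : forall i, has_normal_law P' 1 (Z i).

Local Notation x k w := (layer a (W ^~ w) x0 k).
Local Notation Q w := (sqnorm (map_mx (prelu a) (\col_i Z i w))).
Let L w := ln (Q w).
Let m := fine ('E_P'[L])%E.
Let mu := ln sigma + 2^-1 * m.
Let s2 := 4^-1 * fine ('V_P'[L])%E.
(** The centred increment of [ln ||x^(k)||]: the half comes from the squared norm in [L], and
    [ln sigma] is absorbed by the drift [mu]. *)
Let zeta w := 2^-1 * (L w - m).
Let y k w := ln (enorm (x k w)) - mu * k%:R.

Let mL : measurable_fun setT L.
Proof.
exact: (measurableT_comp (@measurable_ln R) (measurable_sqnorm_prelu a iZ)).
Qed.

Let L4 : P'.-integrable setT (EFin \o (fun w => L w ^+ 4)).
Proof. exact: integrable_ln_pow4. Qed.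

Let mE : \int[P']_w (L w ^+ 1) = m.
Proof. by rewrite /m unlock /Rintegral; under eq_integral do rewrite expr1. Qed.

Let mz : measurable_fun setT zeta.
Proof. by apply: measurable_funM => //; exact: measurable_funB. Qed.

Let z4 : P'.-integrable setT (EFin \o (fun w => zeta w ^+ 4)).
Proof.
(* Coefficients of [((L - m) / 2)^4] in powers of [L]. *)
pose c := nth 0 [:: m ^+ 4 / 16; - m ^+ 3 / 4; 3 / 8 * m ^+ 2; - m / 4; 16^-1].
have [i _] := integral_pow_sum mL L4 c (isT : (5 <= 5)%N).
apply: eq_integrable i => // w _ /=; congr EFin.
by rewrite !big_ord_recr big_ord0/= /c/= /zeta; field.
Qed.

Let z1 : \int[P']_w (zeta w ^+ 1) = 0.
Proof.
pose c := nth 0 [:: - m / 2; 2^-1].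
have [_ e] := integral_pow_sum mL L4 c (isT : (2 <= 5)%N).
transitivity (\int[P']_w (\sum_(i < 2) c i * L w ^+ i)).
  apply: eq_Rintegral => w _.
  by rewrite !big_ord_recr big_ord0/= /c/= /zeta; field.
by rewrite {1}/Rintegral e/= !big_ord_recr big_ord0/= moment0 mE /c/=; field.
Qed.

Let z2 : \int[P']_w (zeta w ^+ 2) = s2.
Proof.
pose c := nth 0 [:: m ^+ 2; - 2 * m; 1].
have [i _] := integral_pow_sum mL L4 c (isT : (3 <= 5)%N).
have {}i : P'.-integrable setT (EFin \o (fun w => (L w - m) * (L w - m))).
  apply: eq_integrable i => // w _ /=; congr EFin.
  by rewrite !big_ord_recr big_ord0/= /c/=; ring.
transitivity (\int[P']_w (4^-1 * ((L w - m) * (L w - m)))).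
  by apply: eq_Rintegral => w _; rewrite /zeta; field.
rewrite (RintegralZl _ measurableT i) /s2; congr (_ * _).
by rewrite /m /Rintegral /variance covariance.unlock expectation.unlock.
Qed.

Let s20 : 0 <= s2.
Proof. by rewrite -z2; apply: Rintegral_ge0 => w _; exact: sqr_ge0. Qed.

Let yE k w : y k w = 2^-1 * ln (sqnorm (x k w)) - mu * k%:R.
Proof. by rewrite /y /enorm ln_sqrtr// sqnorm_ge0. Qed.

Let my k : measurable_fun setT (y k).
Proof.
rewrite (_ : y k = fun w => 2^-1 * ln (sqnorm (x k w)) - mu * k%:R); last first.
  by apply/funext => w; exact: yE.
apply: measurable_funB => //; apply: measurable_funM => //.
exact: (measurableT_comp (@measurable_ln R) (measurable_sqnorm_layer a x0 iW k)).
Qed.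

Let y0 w : y 0 w = ln (enorm x0).
Proof. by rewrite /y mulr0 subr0. Qed.

(** [ln] turns the random factor of [ge0_integral_layerS] into an increment, but splits a product
    only when the factors are positive. The integrands therefore agree almost everywhere: in [w] by
    [layer_neq0_ae], in [w'] because a coordinate of [Z] is almost surely nonzero. *)
Let step k (g : R -> \bar R) : measurable_fun setT g -> (forall x, 0 <= g x)%E ->
  (\int[P]_w g (y k.+1 w) = \int[P]_w \int[P']_w' g (y k w + zeta w')%R)%E.
Proof.
move=> mg g0.
pose G (q : R) := g (2^-1 * ln q - mu * k.+1%:R).
have mG : measurable_fun [set: R] G.
  apply: (measurableT_comp mg); apply: measurable_funB => //.
  by apply: measurable_funM => //; exact: measurable_ln.
have G0 q : (0 <= G q)%E by exact: g0.
transitivity (\int[P]_w G (sqnorm (x k.+1 w)))%E.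
  by apply: eq_integral => w _; rewrite yE.
rewrite (ge0_integral_layerS a x0 sigma0 iW lW iZ lZ k mG G0).
have mQ := measurable_sqnorm_prelu a iZ.
have mq := measurable_sqnorm_layer a x0 iW k.
have m1 : measurable_fun setT (fun p : T * T' => G (sigma ^+ 2 * sqnorm (x k p.1) * Q p.2)).
  apply: (measurableT_comp mG); apply: measurable_funM.
    by apply: measurable_funM => //; exact: (measurableT_comp mq measurable_fst).
  exact: (measurableT_comp mQ measurable_snd).
have m2 : measurable_fun setT (fun p : T * T' => g (y k p.1 + zeta p.2)).
  apply: (measurableT_comp mg); apply: measurable_funD.
    exact: (measurableT_comp (my k) measurable_fst).
  exact: (measurableT_comp mz measurable_snd).
apply: ge0_ae_eq_integral => //.
- exact: (measurable_fun_fubini_tonelli_F (m2 := P') _ m1 (fun p => G0 _)).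
- exact: (measurable_fun_fubini_tonelli_F (m2 := P') _ m2 (fun p => g0 _)).
- by move=> w _; apply: integral_ge0 => w' _; exact: G0.
- by move=> w _; apply: integral_ge0 => w' _; exact: g0.
have a0 : 0 < a by case/andP: a01.
apply: filterS (layer_neq0_ae sigma0 iW lW d0 a0 x00) => w xw _.
have q0 : 0 < sqnorm (x k w).
  by rewrite lt_neqAle eq_sym sqnorm_eq0 xw sqnorm_ge0.
apply: ge0_ae_eq_integral => //.
- exact: (measurableT_comp m1 (pair1_measurable w)).
- exact: (measurableT_comp m2 (pair1_measurable w)).
apply: filterS (prelu_normal_neq0_ae d0 iZ lZ) => w' zw _.
have Q0 := sqnorm_prelu_gt0 a01 zw.
rewrite /G yE /zeta /L; congr (g _).
have s20' : 0 < sigma ^+ 2 by rewrite exprn_gt0.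
rewrite lnM ?posrE ?mulr_gt0// lnM ?posrE// lnXn// -mulr_natl -natr1 /mu.
by field.
Qed.

Let s2E : \int[P']_w (zeta w ^+ 2) = Num.sqrt s2 ^+ 2.
Proof. by rewrite z2 sqr_sqrtr. Qed.

Lemma network_slln : {ae P, forall w,
  (fun k : nat => k%:R^-1 * ln (enorm (x k w))) @ \oo --> mu}.
Proof.
have := walk_slln my y0 step mz z4 z1; apply: filterS => w yw.
have : (fun k : nat => k%:R^-1 * y k w + mu) @ \oo --> 0 + mu.
  by apply: cvgD; [exact: yw|exact: cvg_cst].
rewrite add0r; apply: cvg_trans; apply: near_eq_cvg; near=> k.
have k0 : (0 < k)%N by near: k; exact: nbhs_infty_gt.
rewrite /y mulrBr mulrCA mulVf ?pnatr_eq0 -?lt0n// mulr1.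
by rewrite subrK.
Unshelve. all: by end_near. Qed.

Lemma network_clt : cvg_in_distribution P
  (fun k w => (ln (enorm (x k w)) - mu * k%:R) / Num.sqrt k%:R)
  (centered_normal s2).
Proof.
move=> f cf [B fB].
rewrite (integral_centered_normal s20 cf fB).
have g4 := @integrable_normal_pow4 R.
have g1 : \int[normalR 0 1]_z (z ^+ 1) = 0 :> R.
  by rewrite /Rintegral; under eq_integral do rewrite expr1; rewrite integral_normal_id.
have g2 : \int[normalR 0 1]_z (z ^+ 2) = 1 :> R by rewrite /Rintegral integral_normal_sqr.
have := @walk_clt _ T R P _ T' P' y zeta (ln (enorm x0)) (normalR 0 1) (Num.sqrt s2)
  my y0 step mz z4 z1 s2E (sqrtr_ge0 _) (@ge0_integral_normalRD R) g4 g1 g2 f B cf fB.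
by rewrite expectation.unlock.
Qed.

Lemma network_moments : P'.-integrable setT (EFin \o L) /\
  P'.-integrable setT (EFin \o (fun w => L w ^+ 2)).
Proof.
split; last exact: (integrable_pow_le4 mL L4).
have := integrable_pow_le4 mL L4 (isT : (1 <= 4)%N).
by apply: eq_integrable => // w _ /=; rewrite expr1.
Qed.

End network.
Unset Implicit Arguments.

Theorem mainTheorem8 (R : realType) (d : nat) (dT : measure_display)
  (T : measurableType dT) (P : probability T R)
  (sigma a : R) (x0 : 'cV[R]_d) (W : nat -> T -> 'M[R]_d) :
  (0 < d)%N -> 0 < sigma -> 0 < a <= 1 -> x0 != 0 ->
  (* all entries of all W^(k) are i.i.d. N(0, sigma^2) *)
  mutually_independent P
    (fun p : nat * ('I_d * 'I_d) => fun w => W p.1 w p.2.1 p.2.2) ->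
  (forall k i j, has_normal_law P sigma (fun w => W k w i j)) ->
  (* almost surely, x^(k) <> 0 for every k *)
  {ae P, forall w, forall k, layer a (W ^~ w) x0 k != 0} /\
  (* for any Z ~ N(0, I_d) (on any probability space) *)
  (forall (dT' : measure_display) (T' : measurableType dT')
     (P' : probability T' R) (Z : 'I_d -> T' -> R),
     mutually_independent P' Z ->
     (forall i, has_normal_law P' 1 (Z i)) ->
     let L := fun w' => ln (sqnorm (map_mx (prelu a) (\col_i Z i w'))) in
     let mu := ln sigma + 2^-1 * fine ('E_P'[L])%E in
     let s2 := 4^-1 * fine ('V_P'[L])%E in
     (* finiteness of mu_a(sigma) and s_a^2 *)
     P'.-integrable setT (EFin \o L) /\
     P'.-integrable setT (EFin \o (fun w' => L w' ^+ 2)) /\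
     (* strong law: (1/k) log ||x^(k)|| -> mu a.s. *)
     {ae P, forall w,
       (fun k : nat => k%:R^-1 * ln (enorm (layer a (W ^~ w) x0 k)))
         @ \oo --> mu} /\
     (* CLT *)
     cvg_in_distribution P
       (fun k w => (ln (enorm (layer a (W ^~ w) x0 k)) - mu * k%:R)
                   / Num.sqrt k%:R)
       (centered_normal s2)).
Proof.
move=> d0 sigma0 a01 x00 iW lW; have a0 : 0 < a by case/andP: a01.
split; first exact: (layer_neq0_ae sigma0 iW lW d0 a0 x00).
move=> dT' T' P' Z iZ lZ L mu s2.
have [i1 i2] := network_moments d0 a01 iZ lZ.
split; [exact: i1|split; [exact: i2|split]].
- exact: (network_slln d0 sigma0 a01 x00 iW lW iZ lZ).
- exact: (network_clt d0 sigma0 a01 x00 iW lW iZ lZ).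
Qed.
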